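(* Let $K\ge1$, $K'\ge0$, let $p\ge1$ be an integer, and let $F$ be a $(K,K')$-elliptic polyharmonic mapping in $\mathbb{D}$ of the form $$F(z)=a_0+\sum_{k=1}^p|z|^{2(k-1)}\sum_{n=1}^\infty\left(a_{n,k}z^n+\overline{b_{n,k}z^n}\right),$$ such that, for every $n\ge1$ and all $k_1,k_2,k_3,k_4\in\{1,\dots,p\}$, all non-zero coefficients $a_{n,k_1},a_{n,k_2}$ and $b_{n,k_3},b_{n,k_4}$ satisfy $$\left|\arg\frac{a_{n,k_1}}{a_{n,k_2}}\right|\le\frac{\pi}{2}\quad\text{and}\quad\left|\arg\frac{b_{n,k_3}}{b_{n,k_4}}\right|\le\frac{\pi}{2}.$$ Suppose $\lambda_F(z)\le\lambda$ for all $z\in\mathbb{D}$, where $\lambda$ is a constant, and $F(0)=0$, $\lambda_F(0)=1$. Then $$|a_{n,k}|+|b_{n,k}|\le\frac{\sqrt{(K^2+1)\lambda^2+2K\sqrt{K'}\lambda+K'-1}}{n}\quad\text{for all } n\ge2,\ k=1,$$ $$|a_{n,k}|+|b_{n,k}|\le\frac{\sqrt{(K^2+1)\lambda^2+2K\sqrt{K'}\lambda+K'-1}}{\sqrt{10}}\quad\text{for all } n\ge2,\ 2\le k\le p,$$ $$|a_{n,k}|+|b_{n,k}|\le\frac{\sqrt{(K^2+1)\lambda^2+2K\sqrt{K'}\lambda+K'-1}}{\sqrt{5}}\quad\text{for } n=1,\ 2\le k\le p.$$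
   Context: $\mathbb{D}=\{z\in\mathbb{C}:|z|<1\}$. For a continuously differentiable complex-valued $f$ put $\Lambda_f(z)=|f_z(z)|+|f_{\bar z}(z)|$, $\lambda_f(z)=\big||f_z(z)|-|f_{\bar z}(z)|\big|$, $J_f(z)=|f_z(z)|^2-|f_{\bar z}(z)|^2$. A $2p$-times continuously differentiable complex-valued $F$ is polyharmonic if $\Delta^pF=0$, where $\Delta=4\partial^2/\partial z\partial\bar z$. In $\mathbb{D}$ this is equivalent to $F(z)=\sum_{k=1}^p|z|^{2(k-1)}G_{p-k+1}(z)$ with all $G_{p-k+1}$ complex-valued harmonic in $\mathbb{D}$. In the series representation in the claim, for each $k$ the functions $\sum_{n\ge1}a_{n,k}z^n$ and $\sum_{n\ge1}b_{n,k}z^n$ are analytic in $\mathbb{D}$. A mapping $f$ is ACL in $\mathbb{D}$ if for every closed rectangle $R\subset\mathbb{D}$ with sides parallel to the axes, $f$ is absolutely continuous on almost every horizontal and almost every vertical line in $R$; $f\in ACL^2$ if moreover its partial derivatives are locally $L^2$ in $\mathbb{D}$. A sense-preserving continuous mapping $f:\mathbb{D}\to\mathbb{C}$ is $(K,K')$-elliptic ($K\ge1$, $K'\ge0$) if (1) $f$ is $ACL^2$ in $\mathbb{D}$ and $J_f\ne0$ a.e. in $\mathbb{D}$; and (2) $\Lambda_f^2\le KJ_f+K'$ a.e. in $\mathbb{D}$. (For a continuously differentiable $f$, which is automatically $ACL^2$, sense-preserving is taken to mean $J_f\ge0$, so that $J_f>0$ a.e.) $\arg$ denotes the principal argument, in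 $(-\pi,\pi]$. *)

(* Defs.v *)
From HB Require Import structures.
From mathcomp Require Import all_boot all_order all_algebra.
From mathcomp Require Import all_classical all_reals all_analysis.
From mathcomp Require Import complex.

Set Implicit Arguments.
Unset Strict Implicit.
Unset Printing Implicit Defensive.

Import Order.TTheory GRing.Theory Num.Theory numFieldNormedType.Exports.
Export Normc.

Local Open Scope classical_set_scope.
Local Open Scope ring_scope.
Local Open Scope complex_scope.

(* R[i] with the topology of the modulus. *)
HB.instance Definition _ (R : realType) :=
  NormedModule.copy R[i] R[i]^o.

Section Definitions.
Variable R : realType.
Implicit Types (f g : R[i] -> R[i]) (z : R[i]).

(* Throughout, the modulus as a real number is [normc z : R]; the ring
   norm [`|z|] has values in R[i].  Mappings of the disk are total functions
   on R[i] of which only the values on [unit_disk] matter. *)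
Definition unit_disk : set R[i] := [set z | normc z < 1].

(* Principal argument, in (-pi, pi]; the value at 0 is irrelevant. *)
Definition Carg z : R :=
  if 0 <= complex.Im z then acos (complex.Re z / normc z)
  else - acos (complex.Re z / normc z).

Lemma CargP z : z != 0 ->
  [/\ - pi < Carg z, Carg z <= pi
    & z = (normc z)%:C * (cos (Carg z) +i* sin (Carg z))].
Proof.
move=> z0; have nz0 : normc z != 0 by apply: contra z0 => /eqP/eq0_normc ->.
have n2 : normc z ^+ 2 = complex.Re z ^+ 2 + complex.Im z ^+ 2.
  by case: (z) => x y /=; rewrite sqr_sqrtr// addr_ge0 ?sqr_ge0.
have n_gt0 : 0 < normc z.
  by rewrite lt_neqAle eq_sym nz0; case: (z) => ? ?; exact: sqrtr_ge0.
pose q := complex.Re z / normc z; pose s := complex.Im z / normc z.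
have qs : s ^+ 2 = 1 - q ^+ 2.
  by apply/eqP; rewrite eq_sym subr_eq !expr_div_n -mulrDl addrC -n2 mulfV// expf_neq0.
have q1 : -1 <= q <= 1.
  rewrite -ler_norml -(@expr_le1 _ 2)// real_normK ?num_real// -subr_ge0 -qs.
  exact: sqr_ge0.
have zE : z = (normc z)%:C * (q +i* s).
  apply/eqP; rewrite eq_complex /= !mul0r subr0 addr0 /q /s.
  by rewrite ![normc z * _]mulrC !divfK ?eqxx.
have sa : sin (acos q) = `|s| by rewrite sin_acos// -qs sqrtr_sqr.
rewrite /Carg -/q; case: ifPn => [Im0|]; last rewrite -ltNge => Im0.
  split; [|exact: acos_lepi|].
    by rewrite (lt_le_trans _ (acos_ge0 q1))// oppr_lt0 pi_gt0.
  by rewrite acosK ?in_itv// sa ger0_norm// divr_ge0// ltW.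
have s0 : s < 0 by rewrite pmulr_llt0 ?invr_gt0.
have qN1 : -1 < q <= 1.
  case/andP: q1 => qN1 ->; rewrite andbT lt_neqAle qN1 andbT; apply/eqP => qE.
  by move: qs; rewrite -qE sqrrN expr1n subrr => /eqP; rewrite sqrf_eq0 lt_eqF.
split; [by rewrite ltrN2 acos_ltpi| |].
  by rewrite (@le_trans _ _ 0) ?pi_ge0// oppr_le0 acos_ge0.
by rewrite cosN sinN acosK ?in_itv// sa ltr0_norm// opprK.
Qed.

(* Partial derivatives with respect to x and y, for z = x + i y. *)
Definition d_x f z : R[i] :=
  derive1 (fun t => complex.Re (f (t +i* complex.Im z))) (complex.Re z) +i*
  derive1 (fun t => complex.Im (f (t +i* complex.Im z))) (complex.Re z).

Definition d_y f z : R[i] :=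
  derive1 (fun t => complex.Re (f (complex.Re z +i* t))) (complex.Im z) +i*
  derive1 (fun t => complex.Im (f (complex.Re z +i* t))) (complex.Im z).

Definition has_partials f z : Prop :=
  [/\ derivable (fun t => complex.Re (f (t +i* complex.Im z))) (complex.Re z) 1,
      derivable (fun t => complex.Im (f (t +i* complex.Im z))) (complex.Re z) 1,
      derivable (fun t => complex.Re (f (complex.Re z +i* t))) (complex.Im z) 1
    & derivable (fun t => complex.Im (f (complex.Re z +i* t))) (complex.Im z) 1].

Definition d_z f z : R[i] := (d_x f z - 'i * d_y f z) / 2.
Definition d_zbar f z : R[i] := (d_x f z + 'i * d_y f z) / 2.

Definition Lambda f z : R := normc (d_z f z) + normc (d_zbar f z).
Definition lambda f z : R := `| normc (d_z f z) - normc (d_zbar f z) |.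
Definition Jac f z : R := normc (d_z f z) ^+ 2 - normc (d_zbar f z) ^+ 2.

Definition laplacian f z : R[i] := 4 * d_z (d_zbar f) z.

Fixpoint cont_diff (k : nat) f : Prop :=
  (forall z, unit_disk z -> {for z, continuous f}) /\
  if k is k'.+1 then
    [/\ forall z, unit_disk z -> has_partials f z,
        cont_diff k' (d_x f) & cont_diff k' (d_y f)]
  else True.

Definition polyharmonic (p : nat) f : Prop :=
  cont_diff (2 * p) f /\ forall z, unit_disk z -> iter p laplacian f z = 0.

Definition abs_continuous (c d : R) (h : R -> R[i]) : Prop :=
  forall e : R, 0 < e -> exists2 delta : R, 0 < delta &
    forall (n : nat) (s t : 'I_n -> R),
      (forall i, [/\ c <= s i, s i <= t i & t i <= d]) ->
      (forall i j, i != j -> t i <= s j \/ t j <= s i) ->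
      \sum_(i < n) (t i - s i) < delta ->
      \sum_(i < n) normc (h (t i) - h (s i)) < e.

Definition ACL f : Prop :=
  forall x1 x2 y1 y2 : R, x1 < x2 -> y1 < y2 ->
    (forall x y, x1 <= x <= x2 -> y1 <= y <= y2 -> unit_disk (x +i* y)) ->
    {ae @lebesgue_measure R, forall y, y1 <= y <= y2 ->
       abs_continuous x1 x2 (fun x => f (x +i* y))} /\
    {ae @lebesgue_measure R, forall x, x1 <= x <= x2 ->
       abs_continuous y1 y2 (fun y => f (x +i* y))}.

Definition area := (@lebesgue_measure R \x @lebesgue_measure R)%E.

Definition locally_L2 (h : R[i] -> R) : Prop :=
  forall A : set (R * R), compact A ->
    (forall w, A w -> unit_disk (w.1 +i* w.2)) ->
    measurable_fun A (fun w => h (w.1 +i* w.2)) /\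
    area.-integrable A (fun w => (h (w.1 +i* w.2) ^+ 2)%:E).

Definition ACL2 f : Prop :=
  ACL f /\
  [/\ locally_L2 (fun z => complex.Re (d_x f z)),
      locally_L2 (fun z => complex.Im (d_x f z)),
      locally_L2 (fun z => complex.Re (d_y f z))
    & locally_L2 (fun z => complex.Im (d_y f z))].

Definition ae_disk (P : R[i] -> Prop) : Prop :=
  {ae area, forall w, unit_disk (w.1 +i* w.2) -> P (w.1 +i* w.2)}.

(* This is the meaning of sense-preserving for continuously differentiable
   mappings only. *)
Definition sense_preserving f : Prop := forall z, unit_disk z -> 0 <= Jac f z.

Definition elliptic (K K' : R) f : Prop :=
  [/\ forall z, unit_disk z -> {for z, continuous f},
      sense_preserving f,
      ACL2 f,
      ae_disk (fun z => Jac f z != 0)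
    & ae_disk (fun z => Lambda f z ^+ 2 <= K * Jac f z + K')].

End Definitions.

(* Main.v *)
(* Ellipticity gives Lambda_F <= K lambda_F + sqrt K', hence the pointwise energy
   bound |F_x|^2 + |F_y|^2 = Lambda_F^2 + lambda_F^2 <= M, where M is the constant
   of the theorem plus 1.  On |z| = r the radial and angular derivatives of F
   are the limits, as h -> 0, of the quotients (F(z(1+h)) - F(z))/h and
   (F(z(1+ih)) - F(z))/h, whose Fourier coefficients are explicit.  Bessel's
   inequality (proved with N-th roots of unity, so that no integral is needed),
   then h -> 0 and r -> 1, give
     sum_(n,k) (n^2 + (n+2k-2)^2) (|a_(n,k)|^2 + |b_(n,k)|^2) <= M,
   because the argument condition makes all cross terms nonnegative.  Finally
   lambda_F(0) = 1 reads ||a_(1,1)| - |b_(1,1)|| = 1, so the term n = k = 1 is at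
   least 2, and (|a| + |b|)^2 <= 2 (|a|^2 + |b|^2) concludes. *)

Require Import Defs.
From mathcomp Require Import all_boot all_order all_algebra all_solvable all_field.
From mathcomp Require Import all_classical all_reals all_analysis.
From mathcomp Require Import complex ring lra zify.

Import Order.TTheory GRing.Theory Num.Theory numFieldNormedType.Exports.

Local Open Scope classical_set_scope.
Local Open Scope ring_scope.
Local Open Scope complex_scope.

(** * Discrete Fourier analysis *)

(** The quotients stand in for termwise differentiation: their Fourier coefficients are finite sums
    over [k], so [h -> 0] is taken one frequency at a time, while [F] itself only needs a
    first-order expansion that is uniform along the circle. The weight comes from [|z|^(2k-2) z^n],
    whose logarithmic derivative is [n + 2k - 2] radially and [i n] angularly. For fixed [n] both
    multiply [a_(n,k)] by nonnegative reals, up to a factor [i] common to all [k], so the acute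
    angles survive. Ellipticity holds only almost everywhere, whereas circles are null sets;
    continuity of the partial derivatives closes this gap. The squared denominators are half the
    least weights: 2 n^2 for k = 1, 4^2 + 2^2 = 20 for n, k >= 2, and 3^2 + 1^2 = 10 for n = 1, k >=
    2. The argument gives M - 2 under the root, below the M - 1 of the statement. *)

Section DiscreteFourier.
Set Implicit Arguments.
Unset Strict Implicit.
Variable C : numClosedFieldType.
Implicit Types (w u e : C) (c d q : nat -> C).

(** [X^n - 1] splits and is separable, hence has [n] distinct roots, and that many roots of unity
    must include a primitive one. *)
Lemma prim_root_exists (n : nat) :
  (0 < n)%N -> exists w : C, n.-primitive_root w.
Proof.
pose P : {poly C} := 'X^n - 1; have [r Dp] := closed_field_poly_normal P.
move=> n_gt0; rewrite (monicP _) ?monicXnsubC // scale1r in Dp.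
have rn1 : all n.-unity_root r by apply/allP => z; rewrite -root_prod_XsubC -Dp.
have sz_r : (n < (size r).+1)%N.
  by rewrite -(size_prod_XsubC r id) -Dp size_XnsubC.
have [|z _ zP] := hasP (has_prim_root n_gt0 rn1 _ sz_r); last by exists z.
by rewrite -separable_prod_XsubC -Dp separable_Xn_sub_1 // pnatr_eq0 -lt0n.
Qed.

Lemma mul_conj_norm1 w : `|w| = 1 -> w * w^*%R = 1.
Proof. by move=> w1; rewrite -normCK w1 expr1n. Qed.

Lemma prim_root_norm1 n w : n.-primitive_root w -> `|w| = 1.
Proof.
move=> wP; have n_gt0 := prim_order_gt0 wP.
apply/eqP; rewrite -(@pexpr_eq1 _ _ n) //.
by rewrite -normrX (prim_expr_order wP) normr1.
Qed.

(** Orthogonality of characters: the sum is geometric, its ratio [u] satisfies [u ^+ n = 1], and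
    [u = 1] only if [i = k]. *)
Lemma geometric_prim_root n w i k : n.-primitive_root w -> (i < n)%N -> (k < n)%N ->
  \sum_(j < n) (w ^+ j) ^+ i * ((w ^+ j) ^+ k)^*%R = if i == k then n%:R else 0.
Proof.
move=> wP ilt klt.
have w1 := mul_conj_norm1 (prim_root_norm1 wP).
pose u := w ^+ i * (w^*%R) ^+ k.
have -> : \sum_(j < n) (w ^+ j) ^+ i * ((w ^+ j) ^+ k)^*%R = \sum_(j < n) u ^+ j.
  apply: eq_bigr => j _; rewrite /u exprMn !rmorphXn /= -!exprM.
  by rewrite (mulnC j i) (mulnC j k).
have [ik|neq] := eqVneq i k.
  under eq_bigr => j _ do rewrite /u -ik -exprMn w1 !expr1n.
  by rewrite sumr_const card_ord.
have u1 : u != 1.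
  apply: contra neq => /eqP u1.
  have : u * w ^+ k = w ^+ i by rewrite /u -mulrA -exprMn [w^*%R * _]mulrC w1 expr1n mulr1.
  rewrite u1 mul1r => /esym/eqP; rewrite (eq_prim_root_expr wP).
  by rewrite !modn_small.
apply: (mulfI (_ : u - 1 != 0)); first by rewrite subr_eq0.
rewrite mulr0 -subrX1 /u exprMn -!exprM ![(_ * n)%N]mulnC !exprM.
by rewrite -rmorphXn /= (prim_expr_order wP) rmorph1 !expr1n mulr1 subrr.
Qed.

Lemma discrete_parseval n w q : n.-primitive_root w ->
  \sum_(j < n) `|\sum_(i < n) q i * (w ^+ j) ^+ i| ^+ 2
  = n%:R * \sum_(i < n) `|q i| ^+ 2.
Proof.
move=> wP.
under eq_bigr => j _.
  rewrite normCK rmorph_sum /= big_distrlr /=.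
  under eq_bigr => i _ do under eq_bigr => k _ do rewrite rmorphM mulrACA.
  over.
rewrite exchange_big mulr_sumr /=; apply: eq_bigr => i _.
rewrite exchange_big (bigD1 i) //= -mulr_sumr geometric_prim_root // eqxx.
rewrite normCK mulrC big1 ?addr0 // => k ki.
by rewrite -mulr_sumr geometric_prim_root // val_eqE eq_sym (negPf ki) mulr0.
Qed.

(** On the unit circle the conjugate of [w] is its inverse, so [d m] is the coefficient at frequency
    [- m]. *)
Definition trig_sum (e : C) c d L w : C :=
  e + \sum_(1 <= m < L.+1) (c m * w ^+ m + d m * (w^*%R) ^+ m).

(* On the unit circle, multiplication by [w ^+ L] turns a trigonometric sum of
   order [L] into a polynomial of degree at most [2 * L]. *)
Lemma trig_sum_parseval e c d L w : ((L + L).+1).-primitive_root w ->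
  \sum_(j < (L + L).+1) `|trig_sum e c d L (w ^+ j)| ^+ 2
  = (L + L).+1%:R *
    (`|e| ^+ 2 + \sum_(1 <= m < L.+1) (`|c m| ^+ 2 + `|d m| ^+ 2)).
Proof.
(* Coefficients after the shift by [L]: [d m] sits in degree [L - m], [e] in degree [L], [c m] in
   degree [L + m]. *)
move=> wP; pose q i := if (i < L)%N then d (L - i)%N
  else if i == L then e else c (i - L)%N.
have split_at (T : nmodType) (F : nat -> T) : \sum_(i < (L + L).+1) F i =
    F L + \sum_(1 <= m < L.+1) (F (L + m)%N + F (L - m)%N).
  rewrite -(big_mkord xpredT F) (@big_cat_nat _ _ _ L) //=; last by lia.
  rewrite [X in _ + X]big_ltn; last by lia.
  rewrite addrCA; congr (_ + _); rewrite big_split /= addrC; congr (_ + _).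
    rewrite -[in LHS](addn1 L) -addnS [in LHS]addnC.
    rewrite big_addn; have -> : ((L + L.+1) - L = L.+1)%N by lia.
    by apply: eq_bigr => i _; rewrite addnC.
  rewrite [RHS]big_add1 /= big_nat_rev /=.
  by apply: eq_big_nat => i /andP[_ iL]; congr F; lia.
have w1 : `|w| = 1 := prim_root_norm1 wP.
transitivity (\sum_(j < (L + L).+1)
    `|\sum_(i < (L + L).+1) q i * (w ^+ j) ^+ i| ^+ 2).
  apply: eq_bigr => j _; set x := w ^+ j.
  have x1 : `|x| = 1 by rewrite normrX w1 expr1n.
  have xJ := mul_conj_norm1 x1.
  have -> : \sum_(i < (L + L).+1) q i * x ^+ i = x ^+ L * trig_sum e c d L x.
    rewrite (split_at _ (fun i => q i * x ^+ i)) /trig_sum mulrDr mulr_sumr.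
    rewrite {1}/q ltnn eqxx mulrC; congr (_ + _).
    apply: eq_big_nat => m /andP[m1 mL].
    rewrite mulrDr; congr (_ + _).
      rewrite /q ltnNge leq_addr /= -[X in (_ == X)]addn0 eqn_add2l.
      by rewrite eqn0Ngt m1 /= addKn exprD mulrCA.
    rewrite /q ifT; last by lia.
    rewrite subKn //.
    have {2}-> : (L = L - m + m)%N by lia.
    by rewrite exprD mulrCA -mulrA -exprMn xJ expr1n mulr1.
  by rewrite normrM normrX x1 expr1n mul1r.
rewrite discrete_parseval //; congr (_ * _).
rewrite (split_at _ (fun i => `|q i| ^+ 2)) {1}/q ltnn eqxx; congr (_ + _).
apply: eq_big_nat => m /andP[m1 mL]; congr (_ + _).
  rewrite /q ltnNge leq_addr /= -[X in (_ == X)]addn0 eqn_add2l.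
  by rewrite eqn0Ngt m1 /= addKn.
rewrite /q ifT; last by lia.
by rewrite subKn.
Qed.

(** The pointwise bound is averaged over the [2 L + 1] roots of unity and the constant terms are
    dropped. Two sums are treated together because only the sum of their squares is controlled. *)
Lemma trig_sum_bessel e c d e' c' d' L (B : C) :
  (forall w, `|w| = 1 ->
     `|trig_sum e c d L w| ^+ 2 + `|trig_sum e' c' d' L w| ^+ 2 <= B) ->
  \sum_(1 <= m < L.+1) (`|c m| ^+ 2 + `|d m| ^+ 2 + (`|c' m| ^+ 2 + `|d' m| ^+ 2))
  <= B.
Proof.
move=> leB; have [w wP] := prim_root_exists (ltn0Sn (L + L)).
have wj1 (j : 'I_(L + L).+1) : `|w ^+ j| = 1.
  by rewrite normrX (prim_root_norm1 wP) expr1n.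
have := ler_sum (index_enum 'I_(L + L).+1) (fun j (_ : true) => leB _ (wj1 j)).
rewrite big_split /= !trig_sum_parseval // -mulrDr sumr_const card_ord.
rewrite -[B *+ _]mulr_natl ler_pM2l ?ltr0n //; apply: le_trans.
by rewrite big_split /= addrACA lerDr addr_ge0 // exprn_ge0.
Qed.

End DiscreteFourier.

(** * The modulus as a real number *)

Section Modulus.
Set Implicit Arguments.
Unset Strict Implicit.
Variable R : rcfType.
Implicit Types (x y z w : R[i]) (r : R).

Lemma normC_normc z : `|z| = (normc z)%:C.
Proof. by case: z => x y; rewrite normc_def. Qed.

Lemma normc_ge0 z : 0 <= normc z.
Proof. by case: z => x y; exact: sqrtr_ge0. Qed.

Lemma normc_sq z : normc z ^+ 2 = complex.Re z ^+ 2 + complex.Im z ^+ 2.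
Proof. by case: z => x y /=; rewrite sqr_sqrtr // addr_ge0 ?sqr_ge0. Qed.

Lemma normc_triangle x y : normc (x + y) <= normc x + normc y.
Proof. exact: le_normcD. Qed.

Lemma normcB x y : normc (x - y) = normc (y - x).
Proof. by rewrite -normcN opprB. Qed.

Lemma normc_conj z : normc z^*%R = normc z.
Proof. by case: z => x y /=; rewrite sqrrN. Qed.

Lemma normc_real r : normc r%:C = `|r|.
Proof. by rewrite /= expr0n addr0 sqrtr_sqr. Qed.

Lemma normcX z n : normc (z ^+ n) = normc z ^+ n.
Proof.
elim: n => [|n IH]; first by rewrite !expr0 normc1.
by rewrite !exprS normcM IH.
Qed.

Lemma normc_eq1 w : (`|w| = 1 :> R[i]) <-> normc w = 1.
Proof. by rewrite normC_normc; split => [[]|->]. Qed.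

Lemma conj_real r : (r%:C)^*%R = r%:C.
Proof. exact: conjc_real. Qed.

Lemma normc_sum (I : Type) (s : seq I) (P : pred I) (G : I -> R[i]) :
  normc (\sum_(i <- s | P i) G i) <= \sum_(i <- s | P i) normc (G i).
Proof.
elim/big_ind2: _ => [|x1 x2 y1 y2 h1 h2|i _] //; first by rewrite normc0.
exact: le_trans (normc_triangle _ _) (lerD h1 h2).
Qed.

Lemma normc_le_ReIm z : normc z <= `|complex.Re z| + `|complex.Im z|.
Proof.
rewrite {1}(complexE z); apply: le_trans (normc_triangle _ _) _.
by rewrite normcM !normc_real /= expr0n expr1n add0r sqrtr1 mul1r.
Qed.

Lemma Re_le_normc z : `|complex.Re z| <= normc z.
Proof. by rewrite -lecR -normC_normc normc_ge_Re. Qed.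

Lemma Im_le_normc z : `|complex.Im z| <= normc z.
Proof.
rewrite -(@ler_pXn2r _ 2) // ?nnegrE ?normc_ge0 // normc_sq real_normK ?num_real //.
by rewrite lerDr sqr_ge0.
Qed.

(** Expand [(|x| + eps)^2] and use [2 |x| <= |x|^2 + 1] and [eps^2 <= eps]. In this form no prior
    bound on [|x|] is needed. *)
Lemma normc_sq_perturb x y (eps : R) : 0 < eps -> eps <= 1 -> normc (x - y) <= eps ->
  normc y ^+ 2 <= normc x ^+ 2 * (1 + eps) + eps * 2.
Proof.
move=> e0 e1 xy; have yx : normc y <= normc x + eps.
  rewrite -[y](subKr x) addrC.
  by apply: le_trans (normc_triangle _ _) _; rewrite normcN addrC lerD2l.
move: (normc_ge0 y) (normc_ge0 x) yx.
move: (normc x) (normc y) => u v v0 u0 vu.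
apply: (@le_trans _ _ ((u + eps) ^+ 2)); first by rewrite ler_pXn2r ?nnegrE //; lra.
have : 0 <= eps * (u - 1) ^+ 2 by rewrite mulr_ge0 ?sqr_ge0 // ltW.
have : eps * eps <= eps by rewrite ler_piMr // ltW.
nra.
Qed.

End Modulus.

(** * Uniform Fourier expansions on the unit circle *)

Section Fourier.
Set Implicit Arguments.
Unset Strict Implicit.
Variable R : realType.
Implicit Types (g : R[i] -> R[i]) (c d : nat -> R[i]).

(** The coefficients are specified by uniform convergence of the symmetric partial sums rather than
    by integrals. The constant term is hidden, since it drops out of every estimate. *)
Definition fourier g c d : Prop := exists e : R[i], forall eps : R, 0 < eps ->
  exists L0, forall L, (L0 <= L)%N -> forall w, normc w = 1 ->
    normc (g w - trig_sum e c d L w) <= eps.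

Lemma bessel g c d g' c' d' (B : R) n :
  fourier g c d -> fourier g' c' d' ->
  (forall w, normc w = 1 -> normc (g w) ^+ 2 + normc (g' w) ^+ 2 <= B) ->
  \sum_(1 <= m < n.+1) (normc (c m) ^+ 2 + normc (d m) ^+ 2
    + (normc (c' m) ^+ 2 + normc (d' m) ^+ 2)) <= B.
Proof.
move=> [e ge] [e' ge'] gB.
have B0 : 0 <= B by apply: le_trans (gB 1 (normc1 _)); rewrite addr_ge0 ?sqr_ge0.
apply/ler_addgt0Pr => eta eta0.
(* Perturbing two squares whose sum is at most [B] costs [eps * B + 2 * (2 * eps)], which is
   [eps * (4 + B)]. *)
pose eps := Num.min 1 (eta / (4 + B)).
have eps0 : 0 < eps by rewrite lt_min ltr01 divr_gt0 // ltr_wpDr.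
have eps1 : eps <= 1 by rewrite ge_min lexx.
have eps_eta : eps * (4 + B) <= eta.
  by rewrite -ler_pdivlMr ?ltr_wpDr // ge_min lexx orbT.
have [L1 H1] := ge _ eps0; have [L2 H2] := ge' _ eps0.
pose L := (L1 + L2 + n)%N.
have {}H1 := H1 L (ltac:(rewrite /L; lia)).
have {}H2 := H2 L (ltac:(rewrite /L; lia)).
have sq_le (x y : R[i]) := @normc_sq_perturb _ x y eps eps0 eps1.
apply: (@le_trans _ _ (\sum_(1 <= m < L.+1) (normc (c m) ^+ 2 + normc (d m) ^+ 2
    + (normc (c' m) ^+ 2 + normc (d' m) ^+ 2)))).
  rewrite [leRHS](@big_cat_nat _ _ _ n.+1) //=; last by rewrite /L; lia.
  by rewrite lerDl sumr_ge0 // => i _; rewrite !addr_ge0 ?sqr_ge0.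
rewrite -lecR; set S := \sum_(_ <= _ < _) _.
have -> : S%:C = \sum_(1 <= m < L.+1) (`|c m| ^+ 2 + `|d m| ^+ 2
    + (`|c' m| ^+ 2 + `|d' m| ^+ 2)).
  rewrite /S rmorph_sum; apply: eq_bigr => m _.
  by rewrite !normC_normc !rmorphD !rmorphXn.
apply: (@trig_sum_bessel _ e _ _ e') => w /normc_eq1 w1.
rewrite !normC_normc -!rmorphXn -rmorphD lecR.
have := sq_le _ _ (H1 w w1); have := sq_le _ _ (H2 w w1); have := gB w w1.
move: (normc _ ^+ 2) (normc _ ^+ 2) (normc _ ^+ 2) (normc _ ^+ 2) => u v u' v'.
by nra.
Qed.

Lemma fourierB g c d g' c' d' : fourier g c d -> fourier g' c' d' ->
  fourier (fun w => g w - g' w) (fun m => c m - c' m) (fun m => d m - d' m).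
Proof.
move=> [e ge] [e' ge']; exists (e - e') => eps eps0.
have eps2 : 0 < eps / 2 by rewrite divr_gt0.
have [L1 H1] := ge _ eps2; have [L2 H2] := ge' _ eps2.
exists (L1 + L2)%N => L LL w w1.
have {}H1 := H1 L (ltac:(lia)) w w1; have {}H2 := H2 L (ltac:(lia)) w w1.
have -> : trig_sum (e - e') (fun m => c m - c' m) (fun m => d m - d' m) L w
    = trig_sum e c d L w - trig_sum e' c' d' L w.
  rewrite /trig_sum opprD addrACA -sumrB; congr (_ + _).
  by apply: eq_bigr => m _; ring.
set T := trig_sum _ _ _ _ _; set T' := trig_sum _ _ _ _ _.
have -> : g w - g' w - (T - T') = (g w - T) - (g' w - T') by ring.
apply: le_trans (normc_triangle _ _) _; rewrite normcN [leRHS]splitr.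
exact: lerD.
Qed.

Lemma fourierZ k g c d : fourier g c d ->
  fourier (fun w => k * g w) (fun m => k * c m) (fun m => k * d m).
Proof.
move=> [e ge]; exists (k * e) => eps eps0.
have k0 : 0 < normc k + 1 by rewrite ltr_wpDl ?normc_ge0.
have [L1 H1] := ge _ (divr_gt0 eps0 k0).
exists L1 => L LL w w1; have {}H1 := H1 L LL w w1.
have -> : trig_sum (k * e) (fun m => k * c m) (fun m => k * d m) L w
    = k * trig_sum e c d L w.
  rewrite /trig_sum mulrDr mulr_sumr; congr (_ + _).
  by apply: eq_bigr => m _; ring.
rewrite -mulrBr normcM; apply: le_trans (_ : normc k * (eps / (normc k + 1)) <= _).
  by rewrite ler_wpM2l ?normc_ge0.
by rewrite mulrCA ler_piMr ?(ltW eps0) // ler_pdivrMr // mul1r lerDl.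
Qed.

Lemma fourier_linear (u v : R[i]) : fourier (fun w => u * w + v * w^*)
  (fun m => if m == 1%N then u else 0) (fun m => if m == 1%N then v else 0).
Proof.
exists 0 => eps eps0; exists 1%N => L L1 w w1.
rewrite /trig_sum add0r big_ltn // big_nat big1 ?addr0 /=.
  by rewrite !expr1 subrr normc0 ltW.
by move=> m /andP[m1 _]; rewrite (gtn_eqF m1) !mul0r addr0.
Qed.

End Fourier.

(** * The series of a polyharmonic mapping *)

Section SeriesExpansion.
Variable R : realType.
Set Implicit Arguments.
Unset Strict Implicit.
Implicit Types (u al be : nat -> R[i]).

Lemma cvgn_normc u l : u @ \oo --> l <->
  forall eps : R, 0 < eps -> exists N0, forall n, (N0 <= n)%N -> normc (l - u n) <= eps.
Proof.
split=> [/cvgrPdist_le ul eps eps0|H].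
  have e0 : (0 : R[i]) < eps%:C by rewrite ltcR.
  have [N0 _ HN] := ul _ e0; exists N0 => n Nn.
  by have := HN n Nn; rewrite /= normC_normc lecR.
apply/cvgrPdist_le => eps eps0.
have epsE : eps = (complex.Re eps)%:C by rewrite RRe_real // gtr0_real.
have e0 : 0 < complex.Re eps by rewrite -ltcR -epsE.
have [N0 HN] := H _ e0; exists N0 => // n /= Nn.
by rewrite normC_normc epsE lecR HN.
Qed.

Lemma geometric_tail (q : R) m n : 0 <= q -> q < 1 ->
  \sum_(m <= i < n) q ^+ i <= q ^+ m / (1 - q).
Proof.
move=> q0 q1; have q1' : 0 < 1 - q by lra.
rewrite ler_pdivlMr // mulrC.
have [mn|nm] := leqP m n; last by rewrite big_geq ?mulr0 ?exprn_ge0 // ltnW.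
elim: n mn => [|n IH].
  by rewrite leqn0 => /eqP->; rewrite big_geq // mulr0 exprn_ge0.
rewrite leq_eqVlt => /orP[/eqP->|mn]; first by rewrite big_geq // mulr0 exprn_ge0.
suff -> : (1 - q) * \sum_(m <= i < n.+1) q ^+ i = q ^+ m - q ^+ n.+1.
  by rewrite lerBlDr lerDl exprn_ge0.
elim: n mn {IH} => [|n IH]; rewrite ltnS.
  by rewrite leqn0 => /eqP->; rewrite big_nat1 expr0 expr1 mulr1.
rewrite leq_eqVlt => /orP[/eqP->|mn].
  by rewrite big_nat1 mulrBl mul1r -exprS.
rewrite big_nat_recr //= ?mulrDr ?IH //; last by rewrite ltnW.
by rewrite mulrBl mul1r -exprS; ring.
Qed.

Definition harmonic_sum al be N z : R[i] :=
  \sum_(1 <= n < N) (al n * z ^+ n + (be n * z ^+ n)^*).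

(** At the point [s] the partial sums are eventually within 1 of their limit, and a single term is
    the difference of two consecutive ones. *)
Lemma coefficients_geometric al (s : R) : 0 < s -> s < 1 ->
  (forall z, unit_disk z -> cvgn (fun N => \sum_(1 <= n < N) al n * z ^+ n)) ->
  exists N0, forall n, (N0 <= n)%N -> normc (al n) * s ^+ n <= 2.
Proof.
move=> s0 s1 /(_ s%:C); rewrite /unit_disk /= expr0n addr0 sqrtr_sqr gtr0_norm //.
move=> /(_ s1) /cvg_ex[/= l] /cvgn_normc /(_ 1 ltr01) [N0 HN].
(* The sums start at 1, so [n >= 1] is required for [S n.+1] to exceed [S n] by the [n]-th term. *)
exists (N0 + 1)%N => n Nn; have s_norm : normc s%:C = s by rewrite normc_real gtr0_norm.
rewrite -[s in X in X <= _]s_norm -normcX -normcM.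
pose S N := \sum_(1 <= m < N) al m * s%:C ^+ m.
have -> : al n * s%:C ^+ n = (l - S n) - (l - S n.+1).
  by rewrite opprB addrC addrA subrK /S big_nat_recr /=; [ring|lia].
apply: le_trans (normc_triangle _ _) _; rewrite normcN (_ : 2 = 1 + 1) //.
by apply: lerD; apply: HN; lia.
Qed.

(** Weierstrass test: with [s] midway between [rho] and 1, the terms of both series together are
    eventually at most [4 * q ^+ n], where [q = rho / s < 1]. *)
Lemma harmonic_sum_uniform al be (rho : R) : 0 <= rho -> rho < 1 ->
  (forall z, unit_disk z -> cvgn (fun N => \sum_(1 <= n < N) al n * z ^+ n)) ->
  (forall z, unit_disk z -> cvgn (fun N => \sum_(1 <= n < N) be n * z ^+ n)) ->
  forall eps : R, 0 < eps -> exists L0, forall L, (L0 <= L)%N ->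
    forall z, normc z <= rho ->
    normc (limn (fun N => harmonic_sum al be N z) - harmonic_sum al be L z) <= eps.
Proof.
move=> rho0 rho1 acv bcv eps eps0.
pose s := (rho + 1) / 2; have s0 : 0 < s by rewrite /s; lra.
have s1 : s < 1 by rewrite /s; lra.
pose q := rho / s; have q0 : 0 <= q by rewrite divr_ge0 // ltW.
have q1 : q < 1 by rewrite ltr_pdivrMr // mul1r /s; lra.
have [Na Ha] := coefficients_geometric s0 s1 acv.
have [Nb Hb] := coefficients_geometric s0 s1 bcv.
have q1' : 0 < 1 - q by lra.
have qabs : `|q| < 1 by rewrite ger0_norm.
(* Chosen so that the geometric tail [4 * q ^+ L / (1 - q)] is at most [eps]. *)
have /cvgrPdist_le /(_ (eps * (1 - q) / 4)) := cvg_expr qabs.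
case; first by rewrite divr_gt0 // mulr_gt0.
move=> Nq _ Hq.
exists (maxn (maxn Na Nb) (maxn Nq 1)) => L; rewrite !geq_max.
move=> /andP[/andP[LNa LNb] /andP[LNq L1]] z zrho.
have zD : unit_disk z by apply: le_lt_trans rho1.
have lim_z : (fun N => harmonic_sum al be N z) @ \oo -->
    limn (fun N => harmonic_sum al be N z).
  rewrite -/(cvgn _); apply/cvg_ex.
  have /cvg_ex[/= l /cvgn_normc lH] := acv z zD.
  have /cvg_ex[/= l' /cvgn_normc lH'] := bcv z zD.
  exists (l + l'^*%R); apply/cvgn_normc => e e0.
  have e2 : 0 < e / 2 by rewrite divr_gt0.
  have [N1 H1] := lH _ e2; have [N2 H2] := lH' _ e2.
  exists (maxn N1 N2) => n; rewrite geq_max => /andP[n1 n2].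
  have {}H1 := H1 n n1; have {}H2 := H2 n n2.
  rewrite /harmonic_sum big_split /= -rmorph_sum opprD addrACA -rmorphB /=.
  apply: le_trans (normc_triangle _ _) _.
  by rewrite normc_conj [leRHS]splitr lerD.
have tail n : (L <= n)%N ->
    normc (harmonic_sum al be n z - harmonic_sum al be L z) <= eps.
  move=> Ln; rewrite /harmonic_sum (@big_cat_nat _ _ _ L 1 n) //=.
  rewrite [X in X - _]addrC addrK; apply: le_trans (normc_sum _ _ _) _.
  apply: (@le_trans _ _ (\sum_(L <= i < n) 4 * q ^+ i)).
    apply: ler_sum_nat => i /andP[Li _].
    have term (c : R[i]) : normc c * s ^+ i <= 2 -> normc (c * z ^+ i) <= 2 * q ^+ i.
      move=> cs; rewrite normcM normcX.
      apply: (@le_trans _ _ (normc c * rho ^+ i)).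
        by rewrite ler_wpM2l ?normc_ge0 // lerXn2r // nnegrE ?normc_ge0.
      rewrite /q expr_div_n mulrA ler_pdivlMr ?exprn_gt0 // mulrAC.
      by rewrite ler_wpM2r // exprn_ge0.
    apply: le_trans (normc_triangle _ _) _; rewrite normc_conj.
    have := lerD (term _ (Ha i (leq_trans LNa Li))) (term _ (Hb i (leq_trans LNb Li))).
    by rewrite -mulrDl -natrD.
  rewrite -mulr_sumr.
  have := @geometric_tail q L n q0 q1.
  have := Hq L LNq; rewrite /= sub0r normrN ger0_norm ?exprn_ge0 //.
  rewrite ler_pdivlMr // => h /(fun x => ler_wpM2l (ler0n R 4) x) h'.
  apply: le_trans h' _; rewrite mulrA ler_pdivrMr //; lra.
apply/ler_addgt0Pr => e e0.
have [N0 HN] := (cvgn_normc _ _).1 lim_z e e0.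
have := HN (N0 + L)%N (leq_addr _ _); have := tail (N0 + L)%N (leq_addl _ _).
set l := limn _; set S := harmonic_sum _ _ (N0 + L) z => h1 h2.
have -> (x : R[i]) : l - x = (l - S) + (S - x) by ring.
by apply: le_trans (normc_triangle _ _) _; rewrite addrC lerD.
Qed.

(** Coefficient of [w ^+ m] in [F (z * w)]: for [|w| = 1] the powers of [|z w| = |z|] are constants,
    so the [p] series merge into one trigonometric series. *)
Definition circle_coef (p : nat) (a : nat -> nat -> R[i]) z m : R[i] :=
  (\sum_(1 <= k < p.+1) (normc z)%:C ^+ (2 * (k - 1)) * a m k) * z ^+ m.

Lemma fourier_polyharmonic (p : nat) (F : R[i] -> R[i]) a0 (a b : nat -> nat -> R[i]) :
  (forall k z, (1 <= k <= p)%N -> unit_disk z ->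
     cvgn (fun N => \sum_(1 <= n < N) a n k * z ^+ n)) ->
  (forall k z, (1 <= k <= p)%N -> unit_disk z ->
     cvgn (fun N => \sum_(1 <= n < N) b n k * z ^+ n)) ->
  (forall z, unit_disk z ->
     F z = a0 + \sum_(1 <= k < p.+1) (normc z)%:C ^+ (2 * (k - 1)) *
       \big[+%R/0]_(1 <= n <oo) (a n k * z ^+ n + (b n k * z ^+ n)^*)) ->
  forall z, unit_disk z -> fourier (fun w => F (z * w))
    (circle_coef p a z) (fun m => (circle_coef p b z m)^*%R).
Proof.
move=> acv bcv FE z zD; exists a0 => eps eps0.
have p0 : (0 : R) < p.+1%:R by rewrite ltr0n.
have eps' : 0 < eps / p.+1%:R by rewrite divr_gt0.
(* The range condition stands inside the existential so that [choice] yields a threshold for every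
   natural number [k]. *)
have unif k : exists L0, (1 <= k <= p)%N -> forall L, (L0 <= L)%N ->
    forall x, normc x <= normc z ->
    normc (limn (fun N => harmonic_sum (a^~ k) (b^~ k) N x)
           - harmonic_sum (a^~ k) (b^~ k) L x) <= eps / p.+1%:R.
  have [kp|] := boolP (1 <= k <= p)%N; last by exists 0%N.
  have [L0 H] := harmonic_sum_uniform (normc_ge0 z) zD (fun x => acv k x kp)
    (fun x => bcv k x kp) eps'.
  by exists L0.
have [Lk HLk] := choice unif.
exists (\max_(k < p.+1) Lk k) => L HL w w1.
have zw : normc (z * w) = normc z by rewrite normcM w1 mulr1.
have -> : trig_sum a0 (circle_coef p a z) (fun m => (circle_coef p b z m)^*%R) L w
  = a0 + \sum_(1 <= k < p.+1) (normc z)%:C ^+ (2 * (k - 1)) *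
      harmonic_sum (a^~ k) (b^~ k) L.+1 (z * w).
  rewrite /trig_sum; congr (_ + _).
  rewrite [RHS](eq_bigr (fun k => \sum_(1 <= m < L.+1) (normc z)%:C ^+ (2 * (k - 1)) *
    (a m k * (z * w) ^+ m + (b m k * (z * w) ^+ m)^*))); last first.
    by move=> k _; rewrite /harmonic_sum mulr_sumr.
  rewrite [RHS]exchange_big; apply: eq_bigr => m _ /=.
  rewrite /circle_coef -mulrA rmorphM rmorph_sum -mulrA !mulr_suml -big_split /=.
  apply: eq_bigr => k _.
  rewrite !rmorphM !rmorphXn /= conj_real !rmorphM /= !exprMn; ring.
rewrite FE /unit_disk /= ?zw // opprD addrACA subrr add0r -sumrB.
apply: le_trans (normc_sum _ _ _) _.
apply: (@le_trans _ _ (\sum_(1 <= k < p.+1) eps / p.+1%:R)); last first.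
  rewrite sumr_const_nat subn1 /= -[_ *+ p]mulr_natr mulrAC ler_pdivrMr //.
  by rewrite ler_pM2l // ler_nat.
apply: ler_sum_nat => k /andP[k1 kp]; rewrite -mulrBr normcM normcX normc_real.
rewrite ger0_norm ?normc_ge0 // -[leRHS]mul1r.
apply: ler_pM; rewrite ?normc_ge0 ?exprn_ge0 ?exprn_ile1 ?normc_ge0 ?(ltW zD) //.
apply: HLk; rewrite ?k1 ?zw //.
apply: leq_trans (leq_trans _ HL) (leqnSn _).
exact: (@leq_bigmax _ (fun j : 'I_p.+1 => Lk j) (Ordinal kp)).
Qed.

End SeriesExpansion.

(** * Uniform first-order expansion of a C1 mapping *)

Section ContinuouslyDifferentiable.
Variable R : realType.
Set Implicit Arguments.
Unset Strict Implicit.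
Implicit Types (F g : R[i] -> R[i]) (z w : R[i]).

Lemma mean_value_le (h : R -> R) (s u m eta : R) :
  (forall t, `|t - s| <= `|u| -> derivable h t 1 /\ `|derive1 h t - m| <= eta) ->
  `|h (s + u) - h s - u * m| <= eta * `|u|.
Proof.
move=> H.
have seg (x y : R) : x <= y ->
    (forall t, x <= t <= y -> derivable h t 1 /\ `|derive1 h t - m| <= eta) ->
    `|h y - h x - (y - x) * m| <= eta * (y - x).
  move=> xy Hxy.
  have [t|t|c] := @MVT_segment _ h (derive1 h) x y xy.
  - rewrite in_itv /= => /andP[xt ty]; rewrite derive1E; apply: derivableP.
    by have [|//] := Hxy t _; rewrite !ltW.
  - apply: derivable_within_continuous => c; rewrite in_itv /= => cxy.
    by have [] := Hxy _ cxy.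
  rewrite in_itv /= => cxy ->; rewrite [(y - x) * m]mulrC -mulrBl normrM.
  rewrite (ger0_norm (_ : 0 <= y - x)) ?subr_ge0 // ler_wpM2r ?subr_ge0 //.
  by have [] := Hxy _ cxy.
have [u0|u0] := leP 0 u.
  have := @seg s (s + u); rewrite lerDl (_ : s + u - s = u) ?(ger0_norm u0) //; last by ring.
  apply=> // t /andP[st tu]; apply: H; rewrite !ger0_norm //; lra.
have := @seg (s + u) s; rewrite (_ : s - (s + u) = - u) => [Hseg|]; last by ring.
rewrite (ltr0_norm u0) -normrN.
have -> : - (h (s + u) - h s - u * m) = h s - h (s + u) - - u * m by ring.
apply: Hseg; first by rewrite gerDl ltW.
move=> t /andP[st tu]; apply: H; rewrite (ltr0_norm u0) ler_norml; lra.
Qed.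

Lemma continuous_normcP g z : {for z, continuous g} <->
  forall eps : R, 0 < eps -> exists2 delta : R, 0 < delta &
    forall w, normc (w - z) < delta -> normc (g w - g z) <= eps.
Proof.
split=> [/cvgrPdist_le gz eps eps0|H].
  have e0 : (0 : R[i]) < eps%:C by rewrite ltcR.
  have /nbhs_ballP[d /= d0 dH] := gz _ e0.
  have dE : d = (complex.Re d)%:C by rewrite RRe_real // gtr0_real.
  exists (complex.Re d); first by rewrite -ltcR -dE.
  move=> w wz; rewrite normcB.
  have := dH w; rewrite /= -ball_normE /= !normC_normc lecR; apply.
  by rewrite dE ltcR normcB.
apply: (iffRL (cvgrPdist_le (F := nbhs z) g (g z))) => eps eps0.
have epsE : eps = (complex.Re eps)%:C by rewrite RRe_real // gtr0_real.
have e0 : 0 < complex.Re eps by rewrite -ltcR -epsE.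
have [d d0 dH] := H _ e0.
apply/nbhs_ballP; exists d%:C; first by rewrite /= ltcR.
move=> w; rewrite -ball_normE /= !normC_normc ltcR epsE lecR => zw.
by rewrite normcB; apply: dH; rewrite normcB.
Qed.

Definition C1_on_disk F : Prop := forall z, unit_disk z ->
  [/\ has_partials F z, {for z, continuous (d_x F)} & {for z, continuous (d_y F)}].

Lemma cont_diff_C1 n F : cont_diff n.+1 F -> C1_on_disk F.
Proof.
move=> [_ [hp cx cy]] z zD; split; first exact: hp.
  by case: n cx {cy} => [|n] [cx _]; exact: cx.
by case: n cy {cx} => [|n] [cy _]; exact: cy.
Qed.

(** Move from [z] to [z + w] horizontally, then vertically, and apply the mean value inequality to
    the real and imaginary parts: four errors of size [eps / 4 * |w|]. The base point [z] varies
    too, as the compactness argument requires. *)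
Lemma C1_locally_uniform F z0 : C1_on_disk F -> unit_disk z0 ->
  forall eps : R, 0 < eps -> exists2 delta : R, 0 < delta &
    forall z w, normc (z - z0) < delta -> normc w < delta ->
    normc (F (z + w) - F z
      - ((complex.Re w)%:C * d_x F z + (complex.Im w)%:C * d_y F z))
      <= eps * normc w.
Proof.
move=> F1 z0D eps eps0; have eps8 : 0 < eps / 8 by rewrite divr_gt0.
have [_ /continuous_normcP cx /continuous_normcP cy] := F1 _ z0D.
have [dx dx0 Hx] := cx _ eps8; have [dy dy0 Hy] := cy _ eps8.
pose d := Num.min (1 - normc z0) (Num.min dx dy).
have d0 : 0 < d by rewrite !lt_min dx0 dy0 subr_gt0 z0D.
(* On the path each coordinate differs from that of [z] by at most [|w|], so the distance to [z0]
   stays below [|z - z0| + 2 |w| < d]. *)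
exists (d / 3); first by rewrite divr_gt0.
move=> z w zd wd.
have near x y : `|x - complex.Re z| <= normc w -> `|y - complex.Im z| <= normc w ->
    [/\ has_partials F (x +i* y), normc (d_x F (x +i* y) - d_x F z) <= eps / 4
      & normc (d_y F (x +i* y) - d_y F z) <= eps / 4].
  move=> xw yw.
  have zd' : normc (z - z0) < d by lra.
  have wd' : normc (x +i* y - z0) < d.
    have -> : x +i* y - z0 = (x +i* y - z) + (z - z0) by ring.
    apply: le_lt_trans (normc_triangle _ _) _.
    have := normc_le_ReIm (x +i* y - z).
    have -> : complex.Re (x +i* y - z) = x - complex.Re z by case: (z).
    have -> : complex.Im (x +i* y - z) = y - complex.Im z by case: (z).
    lra.
  move: zd' wd'; rewrite !lt_min => /and3P[z1 zx zy] /and3P[w1 wx wy].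
  have {}w1 : unit_disk (x +i* y).
    rewrite /unit_disk -[_ +i* _](subrK z0).
    apply: le_lt_trans (normc_triangle _ _) _; lra.
  have quarter (u v t : R[i]) : normc (u - t) <= eps / 8 -> normc (v - t) <= eps / 8 ->
      normc (u - v) <= eps / 4.
    have -> : u - v = (u - t) - (v - t) by ring.
    move=> h1 h2; apply: le_trans (normc_triangle _ _) _; rewrite normcN; lra.
  split; first by have [] := F1 _ w1.
  - by apply: (quarter _ _ (d_x F z0)); apply: Hx.
  - by apply: (quarter _ _ (d_y F z0)); apply: Hy.
case: z w => [x y] [u v] /= in near zd wd *; set nw := Num.sqrt _ in near *.
have nwE : nw = normc (u +i* v) by [].
have ule : `|u| <= nw by exact: (Re_le_normc (u +i* v)).
have vle : `|v| <= nw by exact: (Im_le_normc (u +i* v)).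
have nw0 : 0 <= nw by exact: sqrtr_ge0.
have eps4 : 0 <= eps / 4 by rewrite divr_ge0 // ltW.
have hor (part : R[i] -> R) : part = @complex.Re R \/ part = @complex.Im R ->
    `|part (F ((x + u) +i* y)) - part (F (x +i* y)) - u * part (d_x F (x +i* y))|
    <= eps / 4 * nw.
  move=> partE.
  apply: le_trans (_ : eps / 4 * `|u| <= _); last by rewrite ler_wpM2l.
  apply: (@mean_value_le (fun t => part (F (t +i* y)))) => t tu.
  have [|//|[h1 h2 _ _] h _] := near t y.
  - exact: le_trans tu ule.
  - by rewrite subrr normr0.
  case: partE => ->; (split; first by []); apply: le_trans h.
    exact: (Re_le_normc (d_x F (t +i* y) - d_x F (x +i* y))).
  exact: (Im_le_normc (d_x F (t +i* y) - d_x F (x +i* y))).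
have ver (part : R[i] -> R) : part = @complex.Re R \/ part = @complex.Im R ->
    `|part (F ((x + u) +i* (y + v))) - part (F ((x + u) +i* y))
      - v * part (d_y F (x +i* y))|
    <= eps / 4 * nw.
  move=> partE.
  apply: le_trans (_ : eps / 4 * `|v| <= _); last by rewrite ler_wpM2l.
  apply: (@mean_value_le (fun t => part (F ((x + u) +i* t)))) => t tv.
  have [||[_ _ h1 h2] _ h] := near (x + u) t.
  - by rewrite addrAC subrr add0r.
  - exact: le_trans tv vle.
  case: partE => ->; (split; first by []); apply: le_trans h.
    exact: (Re_le_normc (d_y F ((x + u) +i* t) - d_y F (x +i* y))).
  exact: (Im_le_normc (d_y F ((x + u) +i* t) - d_y F (x +i* y))).
apply: le_trans (normc_le_ReIm _) _.
have := hor _ (or_introl erefl); have := hor _ (or_intror erefl).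
have := ver _ (or_introl erefl); have := ver _ (or_intror erefl).
rewrite -[(x +i* y) + (u +i* v)]/((x + u) +i* (y + v)) -/nw.
move: (F _) (F _) (F _) (d_x F _) (d_y F _) => [p1 q1] [p2 q2] [p3 q3] [e1 f1] [e2 f2].
rewrite /= !mul0r !subr0 !addr0.
rewrite (_ : eps / 4 * nw = (eps * nw) / 4); last by ring.
rewrite !ler_norml => /andP[? ?] /andP[? ?] /andP[? ?] /andP[? ?].
set A := `|_|; set B := `|_|.
have ? : A <= (eps * nw) / 2 by rewrite /A ler_norml; lra.
have ? : B <= (eps * nw) / 2 by rewrite /B ler_norml; lra.
lra.
Qed.

Lemma C1_uniform F (rho : R) : C1_on_disk F -> rho < 1 ->
  forall eps : R, 0 < eps -> exists2 delta : R, 0 < delta &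
    forall z w, normc z <= rho -> normc w < delta ->
    normc (F (z + w) - F z
      - ((complex.Re w)%:C * d_x F z + (complex.Im w)%:C * d_y F z))
      <= eps * normc w.
Proof.
move=> F1 rho1 eps eps0.
(* A compact square containing the disk [|z| <= rho]; outside that disk the property [P] is
   vacuous. *)
have : near_covering (`[-1, 1] `*` `[-1, 1] : set (R * R)).
  by apply/compact_near_coveringP/compact_setX; exact: segment_compact.
pose P (delta : R) (q : R * R) := normc (q.1 +i* q.2) <= rho ->
  forall w, normc w < delta ->
  normc (F (q.1 +i* q.2 + w) - F (q.1 +i* q.2)
    - ((complex.Re w)%:C * d_x F (q.1 +i* q.2) + (complex.Im w)%:C * d_y F (q.1 +i* q.2)))
    <= eps * normc w.
move=> /(_ R 0^'+ P _) [].
  move=> [x0 y0] _; set z0 := x0 +i* y0.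
  have box (d : R) x y : 0 < d -> ball x0 (d / 2) x -> ball y0 (d / 2) y ->
      normc (x +i* y - z0) < d.
    move=> d0 hx hy; rewrite normcB; move: hx hy (normc_le_ReIm (z0 - (x +i* y))).
    rewrite /ball /=; lra.
  have [z0D|z0D] := ltP (normc z0) 1.
    have [d d0 Hd] := C1_locally_uniform F1 z0D eps0.
    have d2 : 0 < d / 2 by rewrite divr_gt0.
    exists (ball x0 (d / 2) `*` ball y0 (d / 2), [set t | t < d]).
      split; last exact: nbhs_right_lt.
      by exists (ball x0 (d / 2), ball y0 (d / 2)); [split; exact: nbhsx_ballx|].
    move=> [[x y] t] [[/= hx hy] td] _ w wt.
    by apply: Hd; [exact: box|exact: lt_trans td].
  (* If [|z0| >= 1], no point within [1 - rho] of [z0] has modulus at most [rho]. *)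
  pose d := 1 - rho; have d0 : 0 < d by rewrite subr_gt0.
  have d2 : 0 < d / 2 by rewrite divr_gt0.
  exists (ball x0 (d / 2) `*` ball y0 (d / 2), setT).
    split; last exact: filterT.
    by exists (ball x0 (d / 2), ball y0 (d / 2)); [split; exact: nbhsx_ballx|].
  move=> [[x y] t] [[/= hx hy] _] xy; have {}xy : normc (x +i* y) <= rho := xy.
  have := box _ _ _ d0 hx hy.
  have := normc_triangle (x +i* y) (z0 - (x +i* y)); rewrite [_ + (z0 - _)]addrC subrK.
  by rewrite [normc (z0 - _)]normcB /d; lra.
move=> d /= d0 Hd; exists (d / 2); first by rewrite divr_gt0.
move=> [x y] w zrho wd.
have xy1 : normc (x +i* y) <= 1 by apply: le_trans zrho (ltW rho1).
refine (Hd (d / 2) _ _ (x, y) _ zrho w wd).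
- by rewrite /ball /= sub0r normrN ger0_norm; lra.
- by rewrite divr_gt0.
split=> /=; rewrite in_itv /= -ler_norml.
  exact: le_trans (Re_le_normc (x +i* y)) xy1.
exact: le_trans (Im_le_normc (x +i* y)) xy1.
Qed.

End ContinuouslyDifferentiable.

(** * Elliptic mappings *)

Section Ellipticity.
Variable R : realType.
Set Implicit Arguments.
Unset Strict Implicit.
Implicit Types (F g : R[i] -> R[i]) (z w : R[i]) (phi : R[i] -> R).

Lemma continuous_real_normcP phi z : {for z, continuous phi} ->
  forall eps : R, 0 < eps -> exists2 delta : R, 0 < delta &
    forall w, normc (w - z) < delta -> `|phi z - phi w| <= eps.
Proof.
move=> /cvgrPdist_le gz eps eps0.
have /nbhs_ballP[d /= d0 dH] := gz _ eps0.
have dE : d = (complex.Re d)%:C by rewrite RRe_real // gtr0_real.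
exists (complex.Re d); first by rewrite -ltcR -dE.
move=> w wz; apply: dH; rewrite -ball_normE /= normC_normc dE ltcR.
by rewrite normcB.
Qed.

Lemma continuous_normc g z : {for z, continuous g} ->
  {for z, continuous (fun w => normc (g w))}.
Proof.
move=> gz; apply: (iffRL (cvgrPdist_le (F := nbhs z) (fun w => normc (g w)) _)).
move=> eps eps0.
have e0 : (0 : R[i]) < eps%:C by rewrite ltcR.
have /cvgrPdist_le /(_ _ e0) := gz; apply: filterS => w /=.
rewrite normC_normc lecR; apply: le_trans.
have tri (x y : R[i]) : normc x - normc y <= normc (x - y).
  by rewrite lerBlDr -{1}(subrK y x) normc_triangle.
rewrite ler_norml tri andbT lerNl opprB normcB; exact: tri.
Qed.

(** A negative value would persist on a small open square inside the disk; that square would lie in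
    the null set, yet it has positive area. *)
Lemma ae_disk_continuous_ge0 phi :
  (forall z, unit_disk z -> {for z, continuous phi}) ->
  ae_disk (fun z => 0 <= phi z) -> forall z, unit_disk z -> 0 <= phi z.
Proof.
move=> phi_cont [A [mA A0 sA]] z zD; rewrite leNgt; apply/negP => phi_neg.
have phi2 : 0 < - phi z / 2 by rewrite divr_gt0 // oppr_gt0.
have [d d0 Hd] := continuous_real_normcP (phi_cont z zD) phi2.
pose r := Num.min d (1 - normc z) / 2.
have m0 : 0 < Num.min d (1 - normc z) by rewrite lt_min d0 subr_gt0 zD.
have r0 : 0 < r by rewrite divr_gt0.
pose x := complex.Re z; pose y := complex.Im z.
pose B : set (R * R) := `]x - r, x + r[ `*` `]y - r, y + r[.
have mB : measurable B by apply: measurableX.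
have BA : B `<=` A.
  move=> [s t] /= [] /=; rewrite !in_itv /= => /andP[s1 s2] /andP[t1 t2].
  apply: sA => /= H.
  have near_z : normc (s +i* t - z) < Num.min d (1 - normc z).
    apply: le_lt_trans (normc_le_ReIm _) _.
    have -> : complex.Re (s +i* t - z) = s - x by rewrite /x; case: (z).
    have -> : complex.Im (s +i* t - z) = t - y by rewrite /y; case: (z).
    have h1 : `|s - x| < r by rewrite ltr_norml; lra.
    have h2 : `|t - y| < r by rewrite ltr_norml; lra.
    by rewrite [ltRHS]splitr ltrD.
  move: near_z; rewrite lt_min => /andP[n1 n2].
  have stD : unit_disk (s +i* t).
    rewrite /unit_disk -[_ +i* _](subrK z).
    apply: le_lt_trans (normc_triangle _ _) _; lra.
  have := H stD; have := Hd _ n1; rewrite ler_norml; lra.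
have : (@area R B <= 0)%E by rewrite -A0; apply: le_measure; rewrite ?inE.
rewrite /area product_measure1E //; apply/negP; rewrite -ltNge.
have itv (u : R) (I : set R := [set` `]u - r, u + r[%R]) : (0 < @lebesgue_measure R I)%E.
  by rewrite /I lebesgue_measure_itv /= lte_fin ifT ?EFinN -?EFinB ?lte_fin; lra.
by apply: mule_gt0; exact: itv.
Qed.

Lemma normc2 : normc (2 : R[i]) = 2 :> R.
Proof. by rewrite -(rmorph_nat (real_complex R)) normc_real normr_nat. Qed.

Lemma normci : normc ('i : R[i]) = 1 :> R.
Proof. by rewrite /= expr0n expr1n add0r sqrtr1. Qed.

Lemma continuous_wirtinger F z :
  {for z, continuous (d_x F)} -> {for z, continuous (d_y F)} ->
  {for z, continuous (d_z F)} /\ {for z, continuous (d_zbar F)}.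
Proof.
move=> /continuous_normcP cx /continuous_normcP cy.
have half (s : R[i]) g : normc s = 1 ->
    (forall w, g w = (d_x F w + s * d_y F w) / 2) -> {for z, continuous g}.
  move=> s1 gE; apply/continuous_normcP => eps eps0.
  have [d1 d10 H1] := cx _ eps0; have [d2 d20 H2] := cy _ eps0.
  exists (Num.min d1 d2) => [|w]; rewrite lt_min ?d10 // => /andP[w1 w2].
  have {}H1 := H1 w w1; have {}H2 := H2 w w2; rewrite !gE.
  have -> : (d_x F w + s * d_y F w) / 2 - (d_x F z + s * d_y F z) / 2 =
    ((d_x F w - d_x F z) + s * (d_y F w - d_y F z)) / 2 by ring.
  rewrite normcM normcV normc2 ler_pdivrMr //.
  apply: le_trans (normc_triangle _ _) _; rewrite normcM s1 mul1r.
  rewrite [leRHS](_ : _ = eps + eps).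
    exact: (lerD H1 H2).
  ring.
split; last by apply: (half 'i) => //; exact: normci.
apply: (half (- 'i)) => [|w]; first by rewrite normcN; exact: normci.
by rewrite mulNr.
Qed.

(** Needed because the inequality will be evaluated on circles, which an exceptional null set could
    contain. *)
Lemma elliptic_everywhere K K' F : C1_on_disk F ->
  ae_disk (fun z => Lambda F z ^+ 2 <= K * Jac F z + K') ->
  forall z, unit_disk z -> Lambda F z ^+ 2 <= K * Jac F z + K'.
Proof.
move=> F1 ell z zD; rewrite -subr_ge0.
pose phi z := K * Jac F z + K' - Lambda F z ^+ 2.
apply: (@ae_disk_continuous_ge0 phi) => //; last first.
  case: ell => A [mA A0 sA]; exists A; split=> //; apply: subset_trans sA.
  by apply: subsetC => w H wD; rewrite subr_ge0; exact: H.
move=> {z zD} z zD; have [_ cx cy] := F1 z zD.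
have [cz czb] := continuous_wirtinger cx cy.
have {}cz := continuous_normc cz; have {}czb := continuous_normc czb.
have cstR (c : R) : {for z, continuous ((fun=> c) : R[i] -> R)} by exact: cst_continuous.
pose P w := normc (d_z F w); pose Q w := normc (d_zbar F w).
have P2 : {for z, continuous (P \* P)} by exact: continuousM.
have Q2 : {for z, continuous (Q \* Q)} by exact: continuousM.
have PQ : {for z, continuous (P + Q)} by exact: continuousD.
have PQ2 : {for z, continuous ((P + Q) \* (P + Q))} by exact: continuousM.
have J : {for z, continuous (P \* P - Q \* Q)} by exact: continuousB.
have KJ : {for z, continuous ((fun=> K) \* (P \* P - Q \* Q))} by exact: continuousM.
have KJ' : {for z, continuous ((fun=> K) \* (P \* P - Q \* Q) + (fun=> K'))}.
  exact: continuousD.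
exact: (continuousB KJ' PQ2).
Qed.

(** The parallelogram law, once for [d_x F] and ['i * d_y F], once for the two Wirtinger moduli;
    both sides equal [2 * (P ^+ 2 + Q ^+ 2)]. *)
Lemma partials_energy F z : normc (d_x F z) ^+ 2 + normc (d_y F z) ^+ 2
  = Lambda F z ^+ 2 + lambda F z ^+ 2.
Proof.
rewrite /Lambda /lambda real_normK ?num_real //.
set P := normc (d_z F z); set Q := normc (d_zbar F z).
have -> : (P + Q) ^+ 2 + (P - Q) ^+ 2 = 2 * (P ^+ 2 + Q ^+ 2) by ring.
have half (x : R[i]) : normc (x / 2) ^+ 2 = normc x ^+ 2 / 4.
  by rewrite normcM normcV normc2 expr_div_n; congr (_ / _); ring.
rewrite /P /Q /d_z /d_zbar 2!half 4!normc_sq.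
by case: (d_x F z) (d_y F z) => [x x'] [y y'] /=; field.
Qed.

Lemma elliptic_energy_bound K K' lam F : 1 <= K -> 0 <= K' -> C1_on_disk F ->
  elliptic K K' F -> (forall z, unit_disk z -> lambda F z <= lam) ->
  forall z, unit_disk z -> normc (d_x F z) ^+ 2 + normc (d_y F z) ^+ 2
    <= (K ^+ 2 + 1) * lam ^+ 2 + 2 * K * Num.sqrt K' * lam + K'.
Proof.
move=> K1 K'0 F1 [_ sp _ _ ell] lam_le z zD.
have := elliptic_everywhere F1 ell zD; have := sp z zD; have := lam_le z zD.
rewrite partials_energy /Lambda /lambda /Jac.
have := normc_ge0 (d_z F z); have := normc_ge0 (d_zbar F z).
move: (normc _) (normc _) => P Q Q0 P0.
have s0 := sqrtr_ge0 K'; rewrite -{1 3}(sqr_sqrtr K'0); move: (Num.sqrt K') s0 => s s0.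
move=> + PQ; rewrite subr_ge0 ler_pXn2r ?nnegrE // in PQ.
rewrite ger0_norm ?subr_ge0 // subr_sqr.
set l := P - Q; set L := P + Q => l_lam LL.
have l0 : 0 <= l by rewrite subr_ge0.
have L0 : 0 <= L by rewrite addr_ge0.
have Kl0 : 0 <= K * l by rewrite mulr_ge0 //; lra.
(* Sense preservation makes the Jacobian the product [l * L], so ellipticity reads
   [L * (L - K * l) <= s ^+ 2]; if [L > K * l + s], the left side would exceed [L * s >= s ^+ 2]. *)
have L_le : L <= K * l + s.
  rewrite leNgt; apply/negP => L_gt.
  have : s * s <= L * s by rewrite ler_wpM2r //; lra.
  have : L * s < L * (L - K * l) by rewrite ltr_pM2l; lra.
  nra.
have lam0 : 0 <= lam by apply: le_trans l_lam.
have L2 : L ^+ 2 <= (K * l + s) ^+ 2 by rewrite ler_pXn2r ?nnegrE ?addr_ge0.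
have l2 : l ^+ 2 <= lam ^+ 2 by rewrite ler_pXn2r ?nnegrE.
have : K ^+ 2 * l ^+ 2 <= K ^+ 2 * lam ^+ 2 by rewrite ler_wpM2l ?sqr_ge0.
have : K * s * l <= K * s * lam by rewrite ler_wpM2l // mulr_ge0 //; lra.
nra.
Qed.

End Ellipticity.

(** * Dilations of a circle *)

Section FirstOrder.
Variable R : realType.
Set Implicit Arguments.
Unset Strict Implicit.
Implicit Types (phi psi : R -> R[i]) (d : R[i]).

(** One-sided expansion [1 + h d + O(h^2)] with explicit constant. Normalising the value at 0 to 1
    makes [d] a logarithmic derivative, additive under products. *)
Definition first_order phi d : Prop := exists2 C : R, 0 <= C &
  forall h, 0 < h -> h <= 1 -> normc (phi h - 1 - h%:C * d) <= C * h ^+ 2.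

Lemma first_order_affine s : first_order (fun h => 1 + h%:C * s) s.
Proof.
exists 0 => // h _ _.
have -> : 1 + h%:C * s - 1 - h%:C * s = 0 by ring.
by rewrite normc0 mul0r.
Qed.

Lemma first_order1 : first_order (fun=> 1) 0.
Proof. by exists 0 => // h _ _; rewrite subrr mulr0 subrr normc0 mul0r. Qed.

Lemma first_orderM phi psi d d' : first_order phi d -> first_order psi d' ->
  first_order (fun h => phi h * psi h) (d + d').
Proof.
move=> [C C0 HC] [C' C'0 HC'].
(* One summand for each term of the splitting of [phi h * psi h - 1 - h%:C * (d + d')] below. *)
exists (C * (1 + normc d' + C') + (1 + normc d) * C' + normc d * normc d').
  by rewrite !addr_ge0 ?mulr_ge0 ?addr_ge0 ?normc_ge0 ?ler01.
move=> h h0 h1; have {}HC := HC h h0 h1; have {}HC' := HC' h h0 h1.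
have hn : normc h%:C = h by rewrite normc_real gtr0_norm.
have hd (e : R[i]) : normc (h%:C * e) <= normc e.
  by rewrite normcM hn ler_piMl ?normc_ge0.
have psi_le : normc (psi h) <= 1 + normc d' + C'.
  have -> : psi h = 1 + h%:C * d' + (psi h - 1 - h%:C * d') by ring.
  apply: le_trans (normc_triangle _ _) (lerD _ _).
    by apply: le_trans (normc_triangle _ _) _; rewrite normc1 lerD2l.
  apply: le_trans HC' _; rewrite ler_piMr // expr_le1 //; lra.
have -> : phi h * psi h - 1 - h%:C * (d + d') =
   (phi h - 1 - h%:C * d) * psi h + (1 + h%:C * d) * (psi h - 1 - h%:C * d')
   + (h%:C * d) * (h%:C * d') by ring.
rewrite [leRHS]mulrDl [X in _ <= X + _]mulrDl.
apply: le_trans (normc_triangle _ _) (lerD _ _); last first.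
  by rewrite !normcM hn expr2 mulrACA mulrC.
apply: le_trans (normc_triangle _ _) (lerD _ _); rewrite normcM.
  by rewrite mulrAC ler_pM ?normc_ge0.
rewrite -mulrA ler_pM ?normc_ge0 //.
by apply: le_trans (normc_triangle _ _) _; rewrite normc1 lerD2l.
Qed.

Lemma first_orderX phi d n : first_order phi d ->
  first_order (fun h => phi h ^+ n) (d *+ n).
Proof.
move=> fo; elim: n => [|n IH]; first exact: first_order1.
rewrite mulrS; under [X in first_order X]funext do rewrite exprS.
exact: first_orderM.
Qed.

(** The squared modulus is exactly [1 + 2 h Re s + h^2 |s|^2]; the even exponents [2 (k - 1)] allow
    working with it instead of the modulus. *)
Lemma first_order_normc s :
  first_order (fun h => ((normc (1 + h%:C * s)) ^+ 2)%:C) ((2 * complex.Re s)%:C).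
Proof.
exists (normc s ^+ 2); first exact: sqr_ge0.
move=> h h0 h1; rewrite -!rmorphM -!rmorphB normc_real.
suff -> : normc (1 + h%:C * s) ^+ 2 - 1 - h * (2 * complex.Re s) = normc s ^+ 2 * h ^+ 2.
  by rewrite ger0_norm // mulr_ge0 ?sqr_ge0.
by rewrite !normc_sq; case: s => x y /=; ring.
Qed.

Lemma first_order_dilation s j m :
  first_order (fun h => ((normc (1 + h%:C * s))%:C ^+ (2 * j)) * (1 + h%:C * s) ^+ m)
    ((2 * complex.Re s)%:C *+ j + s *+ m).
Proof.
under [X in first_order X]funext do rewrite exprM -rmorphXn.
apply: first_orderM; apply: first_orderX; last exact: first_order_affine.
exact: first_order_normc.
Qed.

Lemma first_order_sum (p : nat) (phi : nat -> R -> R[i]) (d al : nat -> R[i]) (eps : R) :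
  (forall k, first_order (phi k) (d k)) -> 0 < eps ->
  \forall h \near 0^'+, normc (h^-1%:C *
    (\sum_(1 <= k < p.+1) al k * phi k h - \sum_(1 <= k < p.+1) al k)
    - \sum_(1 <= k < p.+1) al k * d k) <= eps.
Proof.
move=> fo eps0.
have /choice[C HC] : forall k, exists C : R, 0 <= C /\ forall h, 0 < h -> h <= 1 ->
    normc (phi k h - 1 - h%:C * d k) <= C * h ^+ 2.
  by move=> k; have [C C0 HC] := fo k; exists C.
(* The quotient differs from its limit by at most [D * h]; the added 1 keeps [D] positive. *)
pose D := 1 + \sum_(1 <= k < p.+1) normc (al k) * C k.
have D0 : 0 < D.
  rewrite ltr_wpDr // sumr_ge0 // => k _; rewrite mulr_ge0 ?normc_ge0 //.
  by have [] := HC k.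
near=> h.
have h0 : 0 < h by [].
have h1 : h <= 1 by near: h; exact: nbhs_right_le.
have hD : h <= eps / D by near: h; apply: nbhs_right_le; rewrite divr_gt0.
have hn : h%:C != 0 :> R[i] by rewrite (inj_eq (@complexI _) h 0) gt_eqF.
have -> : h^-1%:C *
    (\sum_(1 <= k < p.+1) al k * phi k h - \sum_(1 <= k < p.+1) al k)
    - \sum_(1 <= k < p.+1) al k * d k
  = h^-1%:C * \sum_(1 <= k < p.+1) al k * (phi k h - 1 - h%:C * d k).
  have hV : h^-1%:C = h%:C^-1 by exact: fmorphV.
  rewrite hV -[X in _ - X](mulKf hn) -mulrBr; congr (_ * _).
  by rewrite mulr_sumr -!sumrB; apply: eq_bigr => k _; ring.
rewrite normcM normc_real gtr0_norm ?invr_gt0 //.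
rewrite ler_pdivrMl //.
apply: le_trans (normc_sum _ _ _) _.
apply: (@le_trans _ _ (D * h ^+ 2)); last first.
  rewrite expr2 mulrCA ler_pM2l //; rewrite ler_pdivlMr // in hD.
  by rewrite mulrC.
rewrite mulrDl mul1r ler_wpDl ?sqr_ge0 // mulr_suml.
apply: ler_sum => k _; rewrite normcM -mulrA ler_wpM2l ?normc_ge0 //.
by have [_ ->] := HC k.
Unshelve. all: by end_near.
Qed.

End FirstOrder.

(** * Fourier coefficients of the difference quotients *)

Section CoefficientInequality.
Variable R : realType.
Set Implicit Arguments.
Unset Strict Implicit.

(* Derivative at [h = 0] of the [m]-th Fourier coefficient of
   [w |-> F (r * (1 + h * s) * w)]. *)
Definition dilation_coef (p : nat) (a : nat -> nat -> R[i]) (s : R[i]) (r : R) m :=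
  \sum_(1 <= k < p.+1) (r%:C ^+ (2 * (k - 1)) * r%:C ^+ m * a m k) *
    ((2 * complex.Re s)%:C *+ (k - 1) + s *+ m).

Lemma radial_difference_coef p (a : nat -> nat -> R[i]) s (r eps : R) m :
  0 < r -> 0 < eps ->
  \forall h \near 0^'+, normc (h^-1%:C *
    (circle_coef p a (r%:C * (1 + h%:C * s)) m - circle_coef p a r%:C m)
    - dilation_coef p a s r m) <= eps.
Proof.
move=> r0 eps0.
have fo k := first_order_dilation s (k - 1) m.
have := first_order_sum p (fun k => r%:C ^+ (2 * (k - 1)) * r%:C ^+ m * a m k) fo eps0.
apply: filterS => h; rewrite /dilation_coef /circle_coef.
congr (normc (_ * (_ - _) - _) <= _); rewrite mulr_suml; apply: eq_bigr => k _.
  rewrite normcM normc_real gtr0_norm // rmorphM !exprMn; ring.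
by rewrite normc_real gtr0_norm //; ring.
Qed.

End CoefficientInequality.

(** * The energy inequality on a fixed circle *)

Section CircleInequality.
Variable R : realType.
Set Implicit Arguments.
Unset Strict Implicit.

Definition directional (F : R[i] -> R[i]) (q v : R[i]) : R[i] :=
  (complex.Re v)%:C * d_x F q + (complex.Im v)%:C * d_y F q.

Lemma directionalZ F q (h : R) v :
  directional F q (h%:C * v) = h%:C * directional F q v.
Proof.
rewrite /directional.
have -> : complex.Re (h%:C * v) = h * complex.Re v by case: v => x y /=; rewrite mul0r subr0.
have -> : complex.Im (h%:C * v) = h * complex.Im v by case: v => x y /=; rewrite mul0r addr0.
by rewrite 2!rmorphM mulrDr 2!mulrA.
Qed.

(** The directions [q] and ['i * q] are orthogonal and of length [|q|], so the Hilbert-Schmidt norm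
    of the differential appears, scaled. *)
Lemma directional_energy F q :
  normc (directional F q q) ^+ 2 + normc (directional F q ('i * q)) ^+ 2
  = normc q ^+ 2 * (normc (d_x F q) ^+ 2 + normc (d_y F q) ^+ 2).
Proof.
rewrite /directional; move: (d_x F q) (d_y F q) => [x1 x2] [y1 y2].
case: q => u v; rewrite 5!normc_sq /=; ring.
Qed.

(** The increment [h s r w] has modulus [h r] for every [w], so the uniform expansion errs by at
    most [eps * h * r]; division by [h] leaves at most [eps]. *)
Lemma dilation_quotient F (r : R) s :
  C1_on_disk F -> 0 < r -> r < 1 -> normc s = 1 ->
  forall eps : R, 0 < eps -> \forall h \near 0^'+,
    unit_disk (r%:C * (1 + h%:C * s)) /\
    forall w, normc w = 1 ->
    normc (h^-1%:C * (F (r%:C * (1 + h%:C * s) * w) - F (r%:C * w))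
      - directional F (r%:C * w) (s * (r%:C * w))) <= eps.
Proof.
move=> F1 r0 r1 s1 eps eps0.
have [d d0 Hd] := C1_uniform F1 r1 eps0.
near=> h.
have h0 : 0 < h by [].
have hd : h < d by near: h; exact: nbhs_right_lt.
have hr : h < 1 - r by near: h; apply: nbhs_right_lt; rewrite subr_gt0.
have rn : normc r%:C = r by rewrite normc_real gtr0_norm.
have hn : normc h%:C = h by rewrite normc_real gtr0_norm.
split=> [|w w1].
  rewrite /unit_disk /= normcM rn.
  apply: (@le_lt_trans _ _ (r * (1 + h))).
    rewrite ler_wpM2l ?(ltW r0) //.
    apply: le_trans (normc_triangle _ _) _.
    by rewrite normc1 normcM hn s1 mulr1.
  have : r * h <= h by rewrite ler_piMl // ltW.
  lra.
pose q := r%:C * w.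
have qn : normc q = r by rewrite normcM rn w1 mulr1.
have wn : normc (h%:C * (s * q)) = h * r by rewrite !normcM hn s1 rn w1 mulr1 mul1r.
have hrd : normc (h%:C * (s * q)) < d.
  by rewrite wn; apply: le_lt_trans hd; rewrite ler_piMr // ltW.
have := Hd q (h%:C * (s * q)); rewrite qn lexx => /(_ isT hrd).
rewrite -/(directional F q _) directionalZ wn.
have -> : q + h%:C * (s * q) = r%:C * (1 + h%:C * s) * w by rewrite /q; ring.
rewrite -/q => H.
have hC : h%:C != 0 :> R[i] by rewrite (inj_eq (@complexI _) h 0) gt_eqF.
have hV : h^-1%:C = h%:C^-1 by exact: fmorphV.
rewrite -[X in _ - X](mulKf hC) -hV -mulrBr normcM normc_real gtr0_norm ?invr_gt0 //.
rewrite ler_pdivrMl //; apply: le_trans H _.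
by rewrite mulrC ler_wpM2r ?(ltW eps0) // ler_piMr // ltW.
Unshelve. all: by end_near.
Qed.

Lemma quadratic_slack (B N e : R) : 0 <= B -> 0 < e -> e <= 1 ->
  (B * (1 + e) + 4 * e) * (1 + e) + 8 * N * e <= B + e * (3 * B + 8 + 8 * N).
Proof.
move=> B0 e0 e1.
have e2 : e * e <= e by rewrite ler_piMr // ltW.
have : B * (e * e) <= B * e by rewrite ler_wpM2l.
nra.
Qed.

Lemma sum4_slack (x y u v e : R) :
  x * (1 + e) + e * 2 + (y * (1 + e) + e * 2) + (u * (1 + e) + e * 2 + (v * (1 + e) + e * 2))
  = (x + y + (u + v)) * (1 + e) + 8 * e.
Proof. ring. Qed.

Lemma circle_inequality (p : nat) F (a b : nat -> nat -> R[i]) (M : R) :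
  C1_on_disk F ->
  (forall z, unit_disk z -> fourier (fun w => F (z * w))
    (circle_coef p a z) (fun m => (circle_coef p b z m)^*%R)) ->
  (forall z, unit_disk z -> normc (d_x F z) ^+ 2 + normc (d_y F z) ^+ 2 <= M) ->
  forall (r : R) n, 0 < r -> r < 1 ->
  \sum_(1 <= m < n.+1)
    (normc (dilation_coef p a 1 r m) ^+ 2 + normc (dilation_coef p b 1 r m) ^+ 2
     + (normc (dilation_coef p a 'i r m) ^+ 2 + normc (dilation_coef p b 'i r m) ^+ 2))
  <= r ^+ 2 * M.
Proof.
move=> F1 ser bound r n r0 r1.
set B := r ^+ 2 * M.
have rn : normc r%:C = r by rewrite normc_real gtr0_norm.
have rD : unit_disk r%:C by rewrite -[unit_disk _]/(is_true (normc r%:C < 1)) rn.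
have M0 : 0 <= M by apply: le_trans (bound _ rD); rewrite addr_ge0 ?sqr_ge0.
have B0 : 0 <= B by rewrite mulr_ge0 ?sqr_ge0.
apply/ler_addgt0Pr => eta eta0.
pose D := 3 * B + 8 + 8 * n%:R.
have D0 : 0 < D by have : 0 <= n%:R :> R := ler0n _ _; rewrite /D; lra.
pose eps := Num.min 1 (eta / D).
have eps0 : 0 < eps by rewrite lt_min ltr01 divr_gt0.
have eps1 : eps <= 1 by rewrite ge_min lexx.
have eps_eta : eps * D <= eta by rewrite -ler_pdivlMr // ge_min lexx orbT.
have lims (c : nat -> nat -> R[i]) s : \forall h \near 0^'+, forall m : 'I_n.+1,
    normc (h^-1%:C * (circle_coef p c (r%:C * (1 + h%:C * s)) m - circle_coef p c r%:C m)
    - dilation_coef p c s r m) <= eps.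
  by apply: filter_forall => m; exact: radial_difference_coef.
have q1 := dilation_quotient F1 r0 r1 (normc1 R) eps0.
have qi := dilation_quotient F1 r0 r1 (normci R) eps0.
(* A single [h] serves both directions and all frequencies up to [n], as only finitely many
   conditions are imposed. *)
have [h [[[zD1 H1] [zDi Hi]] [[La1 Lb1] [Lai Lbi]]]] := filter_ex
  (filterI (filterI q1 qi) (filterI (filterI (lims a 1) (lims b 1))
    (filterI (lims a 'i) (lims b 'i)))).
have sq_le (x y : R[i]) := @normc_sq_perturb _ x y eps eps0 eps1.
set z1 := r%:C * (1 + h%:C * 1) in zD1 H1 La1 Lb1.
set zi := r%:C * (1 + h%:C * 'i) in zDi Hi Lai Lbi.
pose g z w := h^-1%:C * (F (z * w) - F (r%:C * w)).
have gB w : normc w = 1 -> normc (g z1 w) ^+ 2 + normc (g zi w) ^+ 2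
    <= B * (1 + eps) + 4 * eps.
  move=> w1.
  have := H1 w w1; rewrite normcB mul1r => /sq_le h1.
  have := Hi w w1; rewrite normcB => /sq_le hi.
  have qn : normc (r%:C * w) = r by rewrite normcM rn w1 mulr1.
  have E : normc (directional F (r%:C * w) (r%:C * w)) ^+ 2
      + normc (directional F (r%:C * w) ('i * (r%:C * w))) ^+ 2 <= B.
    rewrite directional_energy qn ler_wpM2l ?sqr_ge0 //.
    by apply: bound; rewrite /unit_disk /= qn.
  apply: le_trans (lerD h1 hi) _; rewrite addrACA -mulrDl.
  apply: lerD; first by rewrite ler_wpM2r // addr_ge0 // ltW.
  by rewrite -mulrDr mulrC -natrD.
have fr := ser _ rD.
have conj_diff x y : normc (h^-1%:C * (x^*%R - y^*%R)) = normc (h^-1%:C * (x - y)).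
  by rewrite -rmorphB /= !normcM normc_conj.
pose delta (c : nat -> nat -> R[i]) z m :=
  h^-1%:C * (circle_coef p c z m - circle_coef p c r%:C m).
pose S := \sum_(1 <= m < n.+1)
  (normc (delta a z1 m) ^+ 2 + normc (delta b z1 m) ^+ 2
   + (normc (delta a zi m) ^+ 2 + normc (delta b zi m) ^+ 2)).
have S_le : S <= B * (1 + eps) + 4 * eps.
  have := bessel n (fourierZ h^-1%:C (fourierB (ser _ zD1) fr))
    (fourierZ h^-1%:C (fourierB (ser _ zDi) fr)) gB.
  apply: le_trans; rewrite le_eqVlt; apply/orP; left; apply/eqP/eq_bigr => m _.
  congr (_ + _ + (_ + _)); congr (_ ^+ 2); exact/esym/conj_diff.
set T := \sum_(_ <= _ < _) _.
(* Each of the [n] frequencies contributes four squares, each with additive error [2 * eps]. *)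
have TS : T <= S * (1 + eps) + 8 * n%:R * eps.
  have -> : 8 * n%:R * eps = \sum_(1 <= m < n.+1) 8 * eps.
    rewrite sumr_const_nat subn1 /= -mulr_natr; ring.
  rewrite mulr_suml -big_split /=; apply: ler_sum_nat => m /andP[m1 mn].
  have a1 := sq_le _ _ (La1 (Ordinal mn)); have b1 := sq_le _ _ (Lb1 (Ordinal mn)).
  have ai := sq_le _ _ (Lai (Ordinal mn)); have bi := sq_le _ _ (Lbi (Ordinal mn)).
  apply: le_trans (lerD (lerD a1 b1) (lerD ai bi)) _.
  by rewrite sum4_slack.
have SB : S * (1 + eps) <= (B * (1 + eps) + 4 * eps) * (1 + eps).
  by rewrite ler_wpM2r // addr_ge0 // ltW.
apply: le_trans (le_trans TS (lerD SB (lexx _))) _.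
apply: le_trans (lerD (lexx B) eps_eta); rewrite /D.
exact: quadratic_slack.
Qed.

End CircleInequality.

(** * Coefficients *)

Section AcuteCoefficients.
Variable R : realType.
Set Implicit Arguments.
Unset Strict Implicit.
Implicit Types (x y : R[i]).

(** The real part of [x] times the conjugate of [y]. *)
Definition dotc x y : R :=
  complex.Re x * complex.Re y + complex.Im x * complex.Im y.

Lemma dotcMl x y : dotc (x * y) y = complex.Re x * normc y ^+ 2.
Proof. by rewrite normc_sq /dotc; case: x y => [u v] [s t] /=; ring. Qed.

(** The cosine of the argument of [x / y] is nonnegative, hence so is its real part; a vanishing
    coefficient has inner product 0. *)
Lemma dotc_acute x y : (x != 0 -> y != 0 -> `|Carg (x / y)| <= pi / 2) ->
  0 <= dotc x y.
Proof.
have [->|x0] := eqVneq x 0; first by rewrite /dotc !mul0r addr0.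
have [->|y0] := eqVneq y 0; first by rewrite /dotc !mulr0 addr0.
move=> /(_ isT isT) arg_le; pose q := x / y.
have q0 : q != 0 by rewrite mulf_neq0 // invr_eq0.
have [_ _ qE] := CargP q0.
have Req : 0 <= complex.Re q.
  rewrite qE /= mul0r subr0 mulr_ge0 ?normc_ge0 //.
  by apply: cos_ge0_pihalf; rewrite -ler_norml.
have -> : x = q * y by rewrite /q divfK.
by rewrite dotcMl mulr_ge0 ?sqr_ge0.
Qed.

Lemma normc_sqD x y : normc (x + y) ^+ 2 = normc x ^+ 2 + normc y ^+ 2 + 2 * dotc x y.
Proof. by rewrite 3!normc_sq /dotc; case: x y => [? ?] [? ?] /=; ring. Qed.

Lemma dotcD x x' y : dotc (x + x') y = dotc x y + dotc x' y.
Proof. by rewrite /dotc; case: x x' => [? ?] [? ?] /=; ring. Qed.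

Lemma dotcZ (s t : R) x y : dotc (s%:C * x) (t%:C * y) = s * t * dotc x y.
Proof. by rewrite /dotc; case: x y => [? ?] [? ?] /=; ring. Qed.

Lemma acute_sum_sq p (t : nat -> R) (al : nat -> R[i]) :
  (forall k, 0 <= t k) ->
  (forall k j, (1 <= k <= p)%N -> (1 <= j <= p)%N -> 0 <= dotc (al k) (al j)) ->
  \sum_(1 <= k < p.+1) t k ^+ 2 * normc (al k) ^+ 2
  <= normc (\sum_(1 <= k < p.+1) (t k)%:C * al k) ^+ 2.
Proof.
move=> t0; elim: p => [|p IH] acute; first by rewrite !big_geq // normc0 expr0n.
rewrite big_nat_recr //= [in leRHS]big_nat_recr //= normc_sqD.
have -> : normc ((t p.+1)%:C * al p.+1) ^+ 2 = t p.+1 ^+ 2 * normc (al p.+1) ^+ 2.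
  by rewrite normcM normc_real exprMn real_normK // num_real.
rewrite -[leLHS]addr0; apply: lerD.
  by rewrite lerD2r; apply: IH => k j kp jp; apply: acute; lia.
rewrite mulr_ge0 //.
have : forall k, (1 <= k < p.+1)%N -> 0 <= dotc ((t k)%:C * al k) ((t p.+1)%:C * al p.+1).
  move=> k kp; rewrite dotcZ mulr_ge0 ?mulr_ge0 //; apply: acute; lia.
move: ((t p.+1)%:C * _) => y H; rewrite big_nat.
elim/big_ind: _ => [|x x' hx hx'|//]; last by rewrite dotcD addr_ge0.
by rewrite /dotc !mul0r addr0.
Qed.

Definition energy_weight (m k : nat) : R :=
  (m + 2 * (k - 1))%:R ^+ 2 + m%:R ^+ 2.

(** The squared radial factor [r^(2m + 4(k-1))] is at least [r ^+ E]. Taking one exponent for all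
    [k], and later for all [m <= n], allows a single passage to [r = 1]. *)
Lemma dilation_energy p (a : nat -> nat -> R[i]) (r : R) m E :
  0 < r -> r < 1 -> (2 * (m + 2 * p) <= E)%N ->
  (forall k j, (1 <= k <= p)%N -> (1 <= j <= p)%N -> 0 <= dotc (a m k) (a m j)) ->
  r ^+ E * (\sum_(1 <= k < p.+1) energy_weight m k * normc (a m k) ^+ 2)
  <= normc (dilation_coef p a 1 r m) ^+ 2 + normc (dilation_coef p a 'i r m) ^+ 2.
Proof.
move=> r0 r1 mE acute.
pose rho k := r ^+ (2 * (k - 1)) * r ^+ m.
have rho0 k : 0 <= rho k by rewrite mulr_ge0 ?exprn_ge0 ?(ltW r0).
pose t1 k := rho k * (m + 2 * (k - 1))%:R; pose ti k := rho k * m%:R.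
have -> : dilation_coef p a 1 r m = \sum_(1 <= k < p.+1) (t1 k)%:C * a m k.
  apply: eq_bigr => k _; rewrite /t1 /rho !rmorphM !rmorphXn rmorph_nat /=.
  rewrite mulr1 rmorph_nat natrD natrM -[2 *+ _]mulr_natr -[1 *+ m]/(m%:R); ring.
have -> : dilation_coef p a 'i r m = 'i * \sum_(1 <= k < p.+1) (ti k)%:C * a m k.
  rewrite mulr_sumr; apply: eq_bigr => k _.
  rewrite /ti /rho !rmorphM !rmorphXn rmorph_nat /= mulr0 mul0rn add0r.
  rewrite -['i *+ m]mulr_natr; ring.
rewrite normcM normci mul1r.
apply: le_trans (lerD (acute_sum_sq (t := t1) _ acute) (acute_sum_sq (t := ti) _ acute));
  try by move=> k; rewrite mulr_ge0.
rewrite -big_split mulr_sumr; apply: ler_sum_nat => k /andP[k1 kp] /=.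
rewrite -mulrDl mulrA ler_wpM2r ?sqr_ge0 //.
rewrite /t1 /ti !exprMn -mulrDr ler_wpM2r ?addr_ge0 ?sqr_ge0 //.
rewrite -!exprM -exprD.
by apply: ler_wiXn2l; rewrite ?(ltW r0) ?(ltW r1) //; lia.
Qed.

(** Take [r = 1 - d]: Bernoulli's inequality loses at most [E d X], and [d] is chosen to make this
    at most [e]. *)
Lemma le_of_radial_le E (X M : R) : 0 <= X ->
  (forall r : R, 0 < r -> r < 1 -> r ^+ E * X <= M) -> X <= M.
Proof.
move=> X0 H; apply/ler_addgt0Pr => e e0.
have M0 : 0 <= M.
  apply: le_trans (H (1 / 2) _ _); rewrite ?mulr_ge0 ?exprn_ge0 //; lra.
pose D := E%:R * X + 2; have D0 : 0 < D by rewrite ltr_wpDl ?mulr_ge0 ?ler0n.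
pose d := Num.min (1 / 2) (e / D).
have d0 : 0 < d by rewrite lt_min !divr_gt0.
have d1 : d <= 1 / 2 by rewrite ge_min lexx.
have dD : d * D <= e by rewrite -ler_pdivlMr // ge_min lexx orbT.
have bern n : 1 - n%:R * d <= (1 - d) ^+ n.
  elim: n => [|n IH]; first by rewrite mul0r subr0 expr0.
  rewrite exprS -natr1.
  apply: (@le_trans _ _ ((1 - d) * (1 - n%:R * d))); last by rewrite ler_wpM2l //; lra.
  have : 0 <= n%:R * (d * d) by rewrite mulr_ge0 ?ler0n // mulr_ge0 // ltW.
  nra.
have := H (1 - d); rewrite subr_gt0 gtrBl => /(_ ltac:(lra) d0) HE.
have := ler_wpM2r X0 (bern E); rewrite mulrBl mul1r.
have : E%:R * d * X <= e.
  apply: le_trans dD; rewrite /D mulrDr [d * _]mulrCA mulrA lerDl.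
  by rewrite mulr_ge0 // ltW.
lra.
Qed.

Lemma energy_inequality p F (a b : nat -> nat -> R[i]) (M : R) n :
  C1_on_disk F ->
  (forall z, unit_disk z -> fourier (fun w => F (z * w))
    (circle_coef p a z) (fun m => (circle_coef p b z m)^*%R)) ->
  (forall z, unit_disk z -> normc (d_x F z) ^+ 2 + normc (d_y F z) ^+ 2 <= M) ->
  (forall m k j, (1 <= m)%N -> (1 <= k <= p)%N -> (1 <= j <= p)%N ->
     0 <= dotc (a m k) (a m j)) ->
  (forall m k j, (1 <= m)%N -> (1 <= k <= p)%N -> (1 <= j <= p)%N ->
     0 <= dotc (b m k) (b m j)) ->
  \sum_(1 <= m < n.+1) \sum_(1 <= k < p.+1)
    energy_weight m k * (normc (a m k) ^+ 2 + normc (b m k) ^+ 2) <= M.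
Proof.
move=> F1 ser bound acute_a acute_b.
have W0 m k : 0 <= energy_weight m k by rewrite addr_ge0 ?sqr_ge0.
apply: (@le_of_radial_le (2 * (n + 2 * p))).
  by do 2!(apply: sumr_ge0 => ? _); rewrite mulr_ge0 // addr_ge0 ?sqr_ge0.
move=> r r0 r1.
have M0 : 0 <= M.
  have D0 : unit_disk (0 : R[i]) by rewrite -[unit_disk _]/(is_true (normc 0 < 1)) normc0.
  by apply: le_trans (bound _ D0); rewrite addr_ge0 ?sqr_ge0.
apply: (@le_trans _ _ (r ^+ 2 * M)); last by rewrite ler_piMl // exprn_ile1 // ltW.
apply: le_trans (circle_inequality F1 ser bound n r0 r1).
rewrite mulr_sumr; apply: ler_sum_nat => m /andP[m1 mn].
under eq_bigr do rewrite mulrDr.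
rewrite big_split mulrDr /= addrACA.
by apply: lerD; apply: dilation_energy => //; try lia; move=> k j; auto.
Qed.

End AcuteCoefficients.

(** * Leading coefficients and Wirtinger derivatives at the origin *)

Section LeadingCoefficients.
Variable R : realType.
Set Implicit Arguments.
Unset Strict Implicit.

Lemma directional_wirtinger (F : R[i] -> R[i]) q v :
  directional F q v = d_z F q * v + d_zbar F q * v^*%R.
Proof.
rewrite /directional /d_z /d_zbar; move: (d_x F q) (d_y F q) => X Y.
have -> : (complex.Re v)%:C = (v + v^*%R) / 2 by exact: ReJ_add.
have -> : (complex.Im v)%:C = (v^*%R - v) / 2 * 'i by exact: ImJ_sub.
by field.
Qed.

(** After division by [r] only [k = 1] survives: for [k >= 2] and [r <= 1] the factor [r^(2(k-1))]
    is at most [r]. *)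
Lemma circle_coef1_cvg p (a : nat -> nat -> R[i]) (eps : R) : (1 <= p)%N -> 0 < eps ->
  \forall r \near 0^'+, normc (r^-1%:C * circle_coef p a r%:C 1 - a 1%N 1%N) <= eps.
Proof.
move=> p1 eps0.
pose D := 1 + \sum_(2 <= k < p.+1) normc (a 1%N k).
have D0 : 0 < D by rewrite ltr_wpDr // sumr_ge0 // => k _; exact: normc_ge0.
near=> r.
have r0 : 0 < r by [].
have r1 : r <= 1 by near: r; exact: nbhs_right_le.
have rD : r * D <= eps.
  by rewrite -ler_pdivlMr //; near: r; apply: nbhs_right_le; rewrite divr_gt0.
have rC : r%:C != 0 :> R[i] by rewrite (inj_eq (@complexI _) r 0) gt_eqF.
have rV : r^-1%:C = r%:C^-1 by exact: fmorphV.
rewrite /circle_coef expr1 rV mulrC mulfK // big_ltn // subnn muln0 expr0 mul1r.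
rewrite addrAC subrr add0r.
apply: le_trans (normc_sum _ _ _) _; apply: le_trans rD.
rewrite mulrDr mulr1 ler_wpDl ?(ltW r0) // mulr_sumr; apply: ler_sum_nat => k /andP[k2 _].
rewrite normcM normcX !normc_real normr_id gtr0_norm //.
rewrite ler_wpM2r ?normc_ge0 // -[leRHS]expr1.
by apply: ler_wiXn2l; rewrite ?(ltW r0) //; lia.
Unshelve. all: by end_near.
Qed.

(** On a small circle [F (r w) / r] is uniformly close to [u w + v conj w]; Bessel's inequality at
    frequency 1 carries this over to the coefficients. *)
Lemma leading_coefficients p F (a b : nat -> nat -> R[i]) :
  (1 <= p)%N -> C1_on_disk F -> F 0 = 0 ->
  (forall z, unit_disk z -> fourier (fun w => F (z * w))
    (circle_coef p a z) (fun m => (circle_coef p b z m)^*%R)) ->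
  a 1%N 1%N = d_z F 0 /\ (b 1%N 1%N)^*%R = d_zbar F 0.
Proof.
move=> p1 F1 F0 ser.
set u := d_z F 0; set v := d_zbar F 0.
suff H (eps : R) : 0 < eps ->
    normc (a 1%N 1%N - u) <= 3 * eps /\ normc ((b 1%N 1%N)^*%R - v) <= 3 * eps.
  have zero (x : R[i]) : (forall eps, 0 < eps -> normc x <= 3 * eps) -> x = 0.
    move=> Hx; apply/eq0_normc/le_anti; rewrite normc_ge0 andbT.
    apply/ler_addgt0Pr => e e0; rewrite add0r.
    by apply: le_trans (Hx (e / 3) _) _; rewrite ?divr_gt0 // mulrC divfK.
  by split; apply/eqP; rewrite -subr_eq0; apply/eqP/zero => eps /H[].
move=> eps0; have eps3 : eps + eps <= 3 * eps by lra.
have [d d0 Hd] := C1_uniform F1 ltr01 eps0.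
have [r [[r0 [rd r1]] [Ha Hb]]] := filter_ex
  (filterI (filterI (nbhs_right_gt 0)
                    (filterI (nbhs_right_lt d0) (nbhs_right_lt ltr01)))
           (filterI (circle_coef1_cvg a p1 eps0) (circle_coef1_cvg b p1 eps0))).
have rn : normc r%:C = r by rewrite normc_real gtr0_norm.
have rD : unit_disk r%:C by rewrite -[unit_disk _]/(is_true (normc r%:C < 1)) rn.
have four := fourierB (fourierZ r^-1%:C (ser _ rD)) (fourier_linear u v).
have rC : r%:C != 0 :> R[i] by rewrite (inj_eq (@complexI _) r 0) gt_eqF.
have rV : r^-1%:C = r%:C^-1 by exact: fmorphV.
pose g w := r^-1%:C * F (r%:C * w) - (u * w + v * w^*%R).
have g_le w : normc w = 1 -> normc (g w) <= eps.
  move=> w1; have := Hd 0 (r%:C * w); rewrite normc0 lexx => /(_ isT).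
  rewrite !normcM rn w1 mulr1 => /(_ rd).
  rewrite -/(directional F 0 _) directionalZ directional_wirtinger add0r F0 subr0 => H.
  rewrite /g -[X in _ - X](mulKf rC) -rV -mulrBr normcM normc_real gtr0_norm ?invr_gt0 //.
  by rewrite ler_pdivrMl // [leRHS]mulrC.
have gB w : normc w = 1 -> normc (g w) ^+ 2 + normc (g w) ^+ 2 <= eps ^+ 2 + eps ^+ 2.
  by move=> w1; apply: lerD; rewrite ler_pXn2r ?nnegrE ?normc_ge0 ?(ltW eps0) ?g_le.
(* Bessel's inequality is stated for a pair, so [g] is used twice and the bound is doubled. *)
have := bessel 1 four four gB; rewrite big_nat1 /=.
set x := normc _; set y := normc (_ * _^*%R - v) => xy.
have x0 : 0 <= x by exact: normc_ge0.
have y0 : 0 <= y by exact: normc_ge0.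
have sq t s : 0 <= t -> t ^+ 2 + s ^+ 2 + (t ^+ 2 + s ^+ 2) <= eps ^+ 2 + eps ^+ 2 -> t <= eps.
  move=> t0 ts; rewrite -(@ler_pXn2r _ 2) ?nnegrE ?(ltW eps0) //.
  have := sqr_ge0 s; move: (t ^+ 2) (s ^+ 2) (eps ^+ 2) ts => ? ? ?; lra.
have xe : x <= eps by apply: sq x0 xy.
have ye : y <= eps by apply: sq y0 _; move: xy; rewrite [x ^+ 2 + _]addrC; exact.
have comb (c s t : R[i]) : normc (c - s) <= eps -> normc (c - t) <= eps ->
    normc (s - t) <= 3 * eps.
  have -> : s - t = (c - t) - (c - s) by ring.
  move=> h1 h2; apply: le_trans (normc_triangle _ _) _; rewrite normcN.
  exact: le_trans (lerD h2 h1) eps3.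
split; first exact: comb Ha xe.
apply: (comb (r^-1%:C * (circle_coef p b r%:C 1)^*%R)); last exact: ye.
rewrite -(conj_real r^-1) -rmorphM -rmorphB normc_conj; exact: Hb.
Qed.

End LeadingCoefficients.

(** * Elementary bounds for extracting single terms *)

Section TermBounds.
Variable R : realType.
Set Implicit Arguments.
Unset Strict Implicit.
Implicit Types (g : nat -> R).

Lemma le_sum_nat1 g p k : (forall i, 0 <= g i) -> (1 <= k <= p)%N ->
  g k <= \sum_(1 <= i < p.+1) g i.
Proof.
move=> g0 kp; rewrite (bigD1_seq k) ?iota_uniq //=; last by rewrite mem_index_iota.
by rewrite lerDl sumr_ge0.
Qed.

Lemma le_sum_nat2 g p k : (forall i, 0 <= g i) -> (2 <= k <= p)%N ->
  g 1%N + g k <= \sum_(1 <= i < p.+1) g i.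
Proof.
move=> g0 /andP[k2 kp]; rewrite big_ltn; last by lia.
rewrite lerD2l (bigD1_seq k) ?iota_uniq //=; last by rewrite mem_index_iota k2.
by rewrite lerDl sumr_ge0.
Qed.

Lemma le_sqrt_div (y c Q : R) : 0 <= y -> 0 < c -> y ^+ 2 * c <= Q ->
  y <= Num.sqrt Q / Num.sqrt c.
Proof.
move=> y0 c0 H; rewrite ler_pdivlMr ?sqrtr_gt0 // -(ger0_norm y0) -sqrtr_sqr.
by rewrite -sqrtrM ?sqr_ge0 // ler_wsqrtr.
Qed.

Lemma sum_sq_le2 (x y : R) : (x + y) ^+ 2 <= 2 * (x ^+ 2 + y ^+ 2).
Proof. have := sqr_ge0 (x - y); nra. Qed.

End TermBounds.

Theorem theorem2p4 (R : realType) (K K' lam : R) (p : nat)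
    (F : R[i] -> R[i]) (a0 : R[i]) (a b : nat -> nat -> R[i])
    (K_ge1 : 1 <= K) (K'_ge0 : 0 <= K') (p_ge1 : (1 <= p)%N)
    (F_elliptic : elliptic K K' F)
    (F_polyharmonic : polyharmonic p F)
    (a_cvg : forall k z, (1 <= k <= p)%N -> unit_disk z ->
       cvgn (fun N => \sum_(1 <= n < N) a n k * z ^+ n))
    (b_cvg : forall k z, (1 <= k <= p)%N -> unit_disk z ->
       cvgn (fun N => \sum_(1 <= n < N) b n k * z ^+ n))
    (F_series : forall z, unit_disk z ->
       F z = a0 + \sum_(1 <= k < p.+1) (normc z)%:C ^+ (2 * (k - 1)) *
         \big[+%R/0]_(1 <= n <oo) (a n k * z ^+ n + (b n k * z ^+ n)^*))
    (a_arg : forall n k1 k2, (1 <= n)%N -> (1 <= k1 <= p)%N ->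
       (1 <= k2 <= p)%N -> a n k1 != 0 -> a n k2 != 0 ->
       `|Carg (a n k1 / a n k2)| <= pi / 2)
    (b_arg : forall n k3 k4, (1 <= n)%N -> (1 <= k3 <= p)%N ->
       (1 <= k4 <= p)%N -> b n k3 != 0 -> b n k4 != 0 ->
       `|Carg (b n k3 / b n k4)| <= pi / 2)
    (lambda_le : forall z, unit_disk z -> lambda F z <= lam)
    (F0 : F 0 = 0) (lambda0 : lambda F 0 = 1) :
  [/\ forall n : nat, (2 <= n)%N ->
        normc (a n 1%N) + normc (b n 1%N) <=
        Num.sqrt ((K ^+ 2 + 1) * lam ^+ 2 + 2 * K * Num.sqrt K' * lam + K' - 1)
          / n%:R,
      forall n k : nat, (2 <= n)%N -> (2 <= k <= p)%N ->
        normc (a n k) + normc (b n k) <=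
        Num.sqrt ((K ^+ 2 + 1) * lam ^+ 2 + 2 * K * Num.sqrt K' * lam + K' - 1)
          / Num.sqrt 10
    & forall k : nat, (2 <= k <= p)%N ->
        normc (a 1%N k) + normc (b 1%N k) <=
        Num.sqrt ((K ^+ 2 + 1) * lam ^+ 2 + 2 * K * Num.sqrt K' * lam + K' - 1)
          / Num.sqrt 5].
Proof.
have F1 : C1_on_disk F.
  have [] := F_polyharmonic; case: (p) p_ge1 => // q _.
  by rewrite mulnS; move=> /cont_diff_C1.
set M := (K ^+ 2 + 1) * lam ^+ 2 + 2 * K * Num.sqrt K' * lam + K'.
have bound := elliptic_energy_bound K_ge1 K'_ge0 F1 F_elliptic lambda_le.
have ser := fourier_polyharmonic a_cvg b_cvg F_series.
have acute_a m k j (m1 : (1 <= m)%N) (kp : (1 <= k <= p)%N) (jp : (1 <= j <= p)%N) :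
  0 <= dotc (a m k) (a m j) := dotc_acute (a_arg m k j m1 kp jp).
have acute_b m k j (m1 : (1 <= m)%N) (kp : (1 <= k <= p)%N) (jp : (1 <= j <= p)%N) :
  0 <= dotc (b m k) (b m j) := dotc_acute (b_arg m k j m1 kp jp).
pose S m k := normc (a m k) ^+ 2 + normc (b m k) ^+ 2.
have S0 m k : 0 <= S m k by rewrite addr_ge0 ?sqr_ge0.
have W0 m k : 0 <= energy_weight R m k by rewrite addr_ge0 ?sqr_ge0.
have WS0 m k : 0 <= energy_weight R m k * S m k by rewrite mulr_ge0.
have energy n : \sum_(1 <= m < n.+1) \sum_(1 <= k < p.+1) energy_weight R m k * S m k <= M
  := energy_inequality n F1 ser bound acute_a acute_b.
have S11 : 1 <= S 1%N 1%N.
  have [a11 b11] := leading_coefficients p_ge1 F1 F0 ser.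
  move: lambda0; rewrite /lambda -a11 -b11 normc_conj /S.
  have := normc_ge0 (a 1%N 1%N); have := normc_ge0 (b 1%N 1%N).
  move: (normc _) (normc _) => x y y0 x0 xy.
  have : `|x - y| ^+ 2 = 1 by rewrite xy expr1n.
  rewrite real_normK ?num_real //; nra.
(* The disjunction makes [(n, k)] differ from [(1, 1)], so both terms can be kept; they share a row
   exactly when [n = 1]. *)
have two_terms n k : (1 <= n)%N -> (1 <= k <= p)%N -> (1 < n)%N || (1 < k)%N ->
    energy_weight R n k * S n k <= M - 2.
  move=> n1 kp nk; rewrite lerBrDl.
  have W11 : 2 <= energy_weight R 1 1 * S 1%N 1%N.
    by rewrite /energy_weight subnn muln0 addn0 expr1n; lra.
  apply: le_trans (lerD W11 (lexx _)) _; apply: le_trans (energy n).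
  have row0 m : 0 <= \sum_(1 <= j < p.+1) energy_weight R m j * S m j by rewrite sumr_ge0.
  have [n_le1|n2] := leqP n 1.
    have n1E : n = 1%N by apply/eqP; rewrite eqn_leq n_le1.
    rewrite n1E big_nat1; apply: (le_sum_nat2 (g := fun j => energy_weight R 1 j * S 1%N j)) => //.
    by move: nk; rewrite n1E /= => ->; case/andP: kp.
  have n2n : (2 <= n <= n)%N by rewrite n2 leqnn.
  apply: le_trans (le_sum_nat2 row0 n2n); apply: lerD.
    by apply: (le_sum_nat1 (g := fun j => energy_weight R 1 j * S 1%N j)).
  exact: (le_sum_nat1 (g := fun j => energy_weight R n j * S n j)).
(* The factor 2 absorbs [(|a| + |b|)^2 <= 2 (|a|^2 + |b|^2)]; then [M - 2 <= M - 1]. *)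
have conclude n k (c : R) : (1 <= n)%N -> (1 <= k <= p)%N -> (1 < n)%N || (1 < k)%N ->
    0 < c -> 2 * c <= energy_weight R n k ->
    normc (a n k) + normc (b n k) <= Num.sqrt (M - 1) / Num.sqrt c.
  move=> n1 kp nk c0 cW.
  apply: le_sqrt_div => //; first by rewrite addr_ge0 ?normc_ge0.
  have := two_terms n k n1 kp nk; have := ler_wpM2r (S0 n k) cW.
  have := ler_wpM2r (ltW c0) (sum_sq_le2 (normc (a n k)) (normc (b n k))).
  rewrite -/(S n k); move: (_ ^+ 2 * c) (energy_weight R n k * _) => s w; lra.
have weight n k (u v : nat) : (u <= n)%N -> (v <= n + 2 * (k - 1))%N ->
    v%:R ^+ 2 + u%:R ^+ 2 <= energy_weight R n k.
  by move=> un vn; apply: lerD; rewrite ler_pXn2r ?nnegrE ?ler0n // ler_nat.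
split.
- move=> n n2; have -> : n%:R = Num.sqrt (n%:R ^+ 2) :> R by rewrite sqrtr_sqr ger0_norm.
  apply: conclude; rewrite ?n2 ?exprn_gt0 ?ltr0n //; try lia.
  by apply: le_trans (weight n 1%N n n _ _); rewrite ?leqnn ?leq_addr // -mulr2n mulr_natl.
- move=> n k n2 k2; apply: conclude; rewrite ?n2 //; try lia.
  (* [4^2 + 2^2 = 2 * 10], since [n >= 2] and [n + 2 (k - 1) >= 4]. *)
  apply: le_trans (weight n k 2 4 _ _); try lia.
  by rewrite -!natrX -natrD -natrM ler_nat.
- move=> k k2; apply: conclude; rewrite //; try lia.
  (* [3^2 + 1^2 = 2 * 5], since [1 + 2 (k - 1) >= 3]. *)
  apply: le_trans (weight 1%N k 1%N 3 _ _); try lia.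
  by rewrite -!natrX -natrD -natrM ler_nat.
Qed.
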